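(* There exist a set $A \subseteq \mathbb{N}$ which is explicit, in the sense that there is a deterministic algorithm which, given $n \in \mathbb{N}$, decides whether $n \in A$ in time $(\log n)^{O(1)}$ (polynomial in the number of digits of $n$), and absolute constants $C, c > 0$, such that $\sigma_A(n) \ge 1$ for every $n \in \mathbb{N}$, and $\sigma_A(n) \le C\, n^{c/\log\log n}$ for every $n \in \mathbb{N}$ with $n \ge 3$.
   Context: $\mathbb{N} = \{0,1,2,\ldots\}$. For $A \subseteq \mathbb{N}$ and $n \in \mathbb{N}$, $\sigma_A(n)$ denotes the number of ordered pairs $(a,a') \in A \times A$ with $a + a' = n$. In particular, $\sigma_A(n) \ge 1$ for all $n$ means $A + A = \mathbb{N}$. *)

(* Defs.v *)
From HB Require Import structures.
From mathcomp Require Import all_boot.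

Set Implicit Arguments.
Unset Strict Implicit.
Unset Printing Implicit Defensive.

(* Ordered pairs (a, a') of elements of A with a + a' = n; both components
   are necessarily at most n, whence the ordinals. *)
Definition sigma (A : pred nat) (n : nat) : nat :=
  #|[pred p : 'I_n.+1 * 'I_n.+1 | [&& A p.1, A p.2 & p.1 + p.2 == n]]|.

(* Binary numeral, most significant digit first; 0 is written [:: false]. *)
Definition binary (n : nat) : bitseq :=
  rev (mkseq (fun i => odd (n %/ 2 ^ i)) (trunc_log 2 n).+1).

(* Deterministic multi-tape Turing machines, with k.+1 two-way infinite tapes
   and input on tape ord0. *)

Inductive move := MoveLeft | Stay | MoveRight.

Record machine := Machine {
  state : finType;
  symbol : finType;
  blank : symbol;
  digit : bool -> symbol;
  digit_inj : injective digit;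
  digit_blank : forall b, digit b != blank;
  extra_tapes : nat;
  start : state;
  halting : pred state;
  accepting : pred state;
  trans : state -> {ffun 'I_extra_tapes.+1 -> symbol} ->
          state * ('I_extra_tapes.+1 -> symbol * move)
}.

Section Run.
Variable M : machine.

(* (l, r) is the tape whose content, read from left to right, is rev l ++ r
   surrounded by blanks; the head scans the first symbol of r. *)
Definition tape : Type := (seq (symbol M) * seq (symbol M))%type.

Definition scanned (t : tape) : symbol M := head (blank M) t.2.

Definition write (s : symbol M) (t : tape) : tape := (t.1, s :: behead t.2).

Definition shift (m : move) (t : tape) : tape :=
  match m with
  | MoveLeft => (behead t.1, head (blank M) t.1 :: t.2)
  | Stay => t
  | MoveRight => (scanned t :: t.1, behead t.2)
  end.

Definition config : Type :=
  (state M * {ffun 'I_(extra_tapes M).+1 -> tape})%type.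

Definition step (c : config) : config :=
  if halting c.1 then c else
  let: (q, act) := trans c.1 [ffun i => scanned (c.2 i)] in
  (q, [ffun i => shift (act i).2 (write (act i).1 (c.2 i))]).

Definition init (w : bitseq) : config :=
  (start M, [ffun i => ([::], if i == ord0 then map (@digit M) w else [::])]).

(* Halting configurations are fixed by step, so this says that M halts on w
   after at most T steps, with answer b. *)
Definition answers_within (w : bitseq) (T : nat) (b : bool) : Prop :=
  let q := (iter T step (init w)).1 in halting q /\ accepting q = b.

End Run.

Definition polytime_decidable (A : pred nat) : Prop :=
  exists (M : machine) (c d : nat), forall n : nat,
    answers_within M (binary n) (c * size (binary n) ^ d) (A n).

(* Main.v *)
(* Write a number in mixed radix, with two digits (u, v) in base p for each prime
   p > 10 in turn, and let A be the set of numbers all of whose blocks, except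
   the leading one, satisfy v = a u^2 - e (mod p) with e in {0, 1} and
   a in {2w, w^2 + w, w + 1}, where w is a fixed nonsquare mod p (this is Ruzsa's
   construction).  For given (s, t) the system x + y = s, a x^2 + b y^2 = t is a
   quadratic equation in x, so that it has at most two solutions for each pair
   (a, b); since w is not a square, one of the pairs (w^2 + w, w + 1), (2w, 2w)
   yields a solution, and e absorbs the carry from u to v.  Hence each block
   contributes a factor between 1 and 144 to the number of representations.
   Finally b blocks need b!^2 <= n, so b = O(log n / log log n).

   By Chebyshev's lower bound for the number of primes, only primes polynomial
   in log n occur below n; a Turing machine decides membership in A by in-place
   long division of the input by these primes, all remaining computations being
   performed in unary. *)

Require Import Defs.
From HB Require Import structures.
From mathcomp Require Import all_boot all_order all_algebra.
From mathcomp Require Import all_classical all_reals all_analysis.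
From mathcomp Require Import fingroup cyclic zify ring lra.

Set Implicit Arguments.
Unset Strict Implicit.
Unset Printing Implicit Defensive.

Import Order.TTheory GRing.Theory Num.Theory.

(** * While programs on counters and their compilation to Turing machines *)

(** Both pairs (a, b) satisfy a b / (a + b) = w, so that a quarter of the discriminant of a x^2 + b
    (s - x)^2 = t is (a + b) (t - w s^2). As a + b is (w + 1)^2 for one pair and 4 w for the other,
    this is a square for at least one of them. The leading block has to be exempt because two
    restricted blocks add up to n only modulo p^2: for n < p^2 the sum may overshoot by p^2, and n =
    n + 0 is used instead. The price is that either summand may end at any block, which costs up to
    2 p^2 more representations per block; since the primes are polynomial in log n, raising 144 to
    145 and one factor polynomial in log n pay for all of them. The number n is exponential in the
    length of the input, and no unary counter can hold it in polynomial time; hence programs that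
    have a binary tape besides their counters. All other quantities are polynomial in that length,
    so that primality and w can be found by exhaustive search. *)

Inductive test := NonZero of nat | IsOne | NotBlank.

Inductive cmd :=
  | Inc of nat
  | Dec of nat
  | GoLeft
  | GoRight
  | Put of bool
  | Seq of cmd & cmd
  | If of test & cmd & cmd
  | While of test & cmd.

Record store := Store { cnt : nat -> nat; lft : bitseq; rgt : bitseq }.

Definition upd (f : nat -> nat) (i x : nat) : nat -> nat :=
  fun j => if j == i then x else f j.

Definition holds (t : test) (s : store) : bool :=
  match t with
  | NonZero i => cnt s i != 0
  | IsOne => head false (rgt s)
  | NotBlank => rgt s != [::]
  end.

(* [run c s n s'] only bounds the running time by [n]. *)
Inductive run : cmd -> store -> nat -> store -> Prop :=
  | run_inc i f l r : run (Inc i) (Store f l r) 1 (Store (upd f i (f i).+1) l r)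
  | run_dec i f l r : f i != 0 ->
      run (Dec i) (Store f l r) 1 (Store (upd f i (f i).-1) l r)
  | run_left b f l r : run GoLeft (Store f (b :: l) r) 1 (Store f l (b :: r))
  | run_right b f l r : run GoRight (Store f l (b :: r)) 1 (Store f (b :: l) r)
  | run_put b b' f l r :
      run (Put b) (Store f l (b' :: r)) 1 (Store f l (b :: r))
  | run_seq c d s n s1 m s2 :
      run c s n s1 -> run d s1 m s2 -> run (Seq c d) s (n + m) s2
  | run_if t c d s n s1 :
      run (if holds t s then c else d) s n s1 -> run (If t c d) s n.+1 s1
  | run_while0 t c s : ~~ holds t s -> run (While t c) s 1 s
  | run_whileS t c s n s1 m s2 : holds t s ->
      run c s n s1 -> run (While t c) s1 m s2 -> run (While t c) s (n + m).+1 s2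
  | run_leq c s n m s1 : n <= m -> run c s n s1 -> run c s m s1.

Fixpoint width (c : cmd) : nat :=
  let twidth t := if t is NonZero i then i.+1 else 0 in
  match c with
  | Inc i | Dec i => i.+1
  | Seq c d => maxn (width c) (width d)
  | If t c d => maxn (twidth t) (maxn (width c) (width d))
  | While t c => maxn (twidth t) (width c)
  | _ => 0
  end.

Section Compilation.

Variable K : nat.

(* [None] is the blank and [Some None] marks the origin of a counter tape;
   counter [i] is the distance from the origin to the head of tape [i.+1]. *)
Definition sym : finType := option (option bool).
Definition scan : Type := {ffun 'I_K.+1 -> sym}.
Definition action : Type := 'I_K.+1 -> sym * move.

Definition ctape (i : nat) : 'I_K.+1 := inord i.+1.

Definition act_on (j : 'I_K.+1) (a : sym * move) (x : scan) : action :=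
  fun i => if i == j then a else (x i, Stay).

Definition idle (x : scan) : action := fun i => (x i, Stay).

Definition tested (t : test) (x : scan) : bool :=
  match t with
  | NonZero i => x (ctape i) != Some None
  | IsOne => x ord0 == Some (Some true)
  | NotBlank => x ord0 != None
  end.

(** Places where control can be before a machine step. The additional [None] of [If] and [While] is
    the place where the test is evaluated. *)
Fixpoint point (c : cmd) : Type :=
  match c with
  | Seq c d => point c + point d
  | If _ c d => option (point c + point d)
  | While _ c => option (point c)
  | _ => unit
  end.

(** Finiteness is established apart from [point], along the same recursion, so that [entry] and
    [next] can match on the bare types. *)
Fixpoint point_finite (c : cmd) : Finite.axioms_ (point c) :=
  let F c : finType := Finite.Pack (point_finite c) in
  match c return Finite.axioms_ (point c) with
  | Seq c d => Finite.class (F c + F d)%type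
  | If _ c d => Finite.class (option (F c + F d)%type)
  | While _ c => Finite.class (option (F c))
  | _ => Finite.class unit
  end.

Definition fpoint (c : cmd) : finType := Finite.Pack (point_finite c).

Fixpoint entry (c : cmd) : point c :=
  match c return point c with
  | Seq c d => inl (entry c)
  | If _ c d => None
  | While _ c => None
  | _ => tt
  end.

(** A first component [None] means that the command ends with this step; [Seq] can then pass control
    on at no cost. *)
Fixpoint next (c : cmd) : point c -> scan -> option (point c) * action :=
  match c return point c -> scan -> option (point c) * action with
  | Inc i => fun _ x => (None, act_on (ctape i) (x (ctape i), MoveRight) x)
  | Dec i => fun _ x => (None, act_on (ctape i) (x (ctape i), MoveLeft) x)
  | GoLeft => fun _ x => (None, act_on ord0 (x ord0, MoveLeft) x)
  | GoRight => fun _ x => (None, act_on ord0 (x ord0, MoveRight) x)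
  | Put b => fun _ x => (None, act_on ord0 (Some (Some b), Stay) x)
  | Seq c d => fun p x =>
      match p with
      | inl p => let: (o, a) := next p x in
          (Some (if o is Some p' then inl p' else inr (entry d)), a)
      | inr p => let: (o, a) := next p x in
          (if o is Some p' then Some (inr p') else None, a)
      end
  | If t c d => fun p x =>
      match p with
      | None => (Some (Some (if tested t x then inl (entry c)
                             else inr (entry d))), idle x)
      | Some (inl p) => let: (o, a) := next p x in
          (if o is Some p' then Some (Some (inl p')) else None, a)
      | Some (inr p) => let: (o, a) := next p x in
          (if o is Some p' then Some (Some (inr p')) else None, a)
      end
  | While t c => fun p x =>
      match p with
      | None => (if tested t x then Some (Some (entry c)) else None, idle x)
      | Some p => let: (o, a) := next p x in
          (Some (if o is Some p' then Some p' else None), a)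
      end
  end.

Lemma digit_symK : injective (fun b : bool => Some (Some b) : sym).
Proof. by move=> b b' [->]. Qed.

Lemma digit_sym_neq0 (b : bool) : (Some (Some b) : sym) != None.
Proof. by []. Qed.

Section Compiled.

Variables (prog : cmd) (out : nat).

(* [inr None] writes the origin marks, and [inr (Some None)] tests counter
   [out] once [prog] is over. *)
Definition mstate : finType := (fpoint prog + option (option bool))%type.

Definition mtrans (q : mstate) (x : scan) : mstate * action :=
  match q with
  | inl p => let: (o, a) := next p x in
      (if o is Some p' then inl p' else inr (Some None), a)
  | inr None => (inl (entry prog),
      fun i => if i == ord0 then (x i, Stay) else (Some None, Stay))
  | inr (Some None) => (inr (Some (Some (~~ tested (NonZero out) x))), idle x)
  | inr (Some (Some b)) => (q, idle x)
  end.

Definition compiled : machine :=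
  @Machine mstate sym None (fun b => Some (Some b)) digit_symK digit_sym_neq0
    K (inr None) (fun q => if q is inr (Some (Some _)) then true else false)
    (fun q => if q is inr (Some (Some b)) then b else false) mtrans.

Definition tapes : Type := {ffun 'I_K.+1 -> tape compiled}.

Definition view (T : tapes) : scan := [ffun i => scanned (T i)].

Definition perform (a : action) (T : tapes) : tapes :=
  [ffun i => @Defs.shift compiled (a i).2 (@write compiled (a i).1 (T i))].

(** Execution up to and including the exit from the command; unlike in [run], the number of steps is
    exact. *)
Inductive reach (c : cmd) : point c -> tapes -> nat -> tapes -> Prop :=
  | reach_exit p T a : next p (view T) = (None, a) ->
      reach p T 1 (perform a T)
  | reach_step p T p' a n T' : next p (view T) = (Some p', a) ->
      reach p' (perform a T) n T' -> reach p T n.+1 T'.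

Lemma reach_seqr c d (p : point d) T n T1 :
  reach p T n T1 -> reach (c := Seq c d) (inr p) T n T1.
Proof.
elim=> {p T n T1} [p T a e|p T p' a n T' e _ IH].
  by apply: reach_exit; rewrite /= e.
by refine (reach_step _ IH); rewrite /= e.
Qed.

Lemma reach_seql c d (p : point c) T n T1 m T2 :
  reach p T n T1 -> reach (entry d) T1 m T2 ->
  reach (c := Seq c d) (inl p) T (n + m) T2.
Proof.
elim=> {p T n T1} [p T a e|p T p' a n T' e _ IH] H.
  by rewrite add1n; refine (reach_step _ (reach_seqr c H)); rewrite /= e.
by rewrite addSn; refine (reach_step _ (IH H)); rewrite /= e.
Qed.

Lemma reach_ifl t c d (p : point c) T n T1 :
  reach p T n T1 -> reach (c := If t c d) (Some (inl p)) T n T1.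
Proof.
elim=> {p T n T1} [p T a e|p T p' a n T' e _ IH].
  by apply: reach_exit; rewrite /= e.
by refine (reach_step _ IH); rewrite /= e.
Qed.

Lemma reach_ifr t c d (p : point d) T n T1 :
  reach p T n T1 -> reach (c := If t c d) (Some (inr p)) T n T1.
Proof.
elim=> {p T n T1} [p T a e|p T p' a n T' e _ IH].
  by apply: reach_exit; rewrite /= e.
by refine (reach_step _ IH); rewrite /= e.
Qed.

Lemma reach_while t c (p : point c) T n T1 m T2 :
  reach p T n T1 -> reach (c := While t c) None T1 m T2 ->
  reach (c := While t c) (Some p) T (n + m) T2.
Proof.
elim=> {p T n T1} [p T a e|p T p' a n T' e _ IH] H.
  by rewrite add1n; refine (reach_step _ H); rewrite /= e.
by rewrite addSn; refine (reach_step _ (IH H)); rewrite /= e.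
Qed.

Lemma perform_idle_view (T : tapes) i :
  perform (idle (view T)) T i = ((T i).1, scanned (T i) :: behead (T i).2).
Proof. by rewrite !ffunE /= ffunE. Qed.

Definition all_blank (r : seq sym) := all (pred1 None) r.

(** The blanks after the input are there because [write] on an exhausted right half stores an
    explicit blank. Read leftwards from the head, a counter tape shows as many blanks as the counter
    counts, then the origin mark. *)
Definition represents (s : store) (T : tapes) : Prop :=
  [/\ (T ord0).1 = [seq Some (Some b) | b <- lft s],
      exists j, (T ord0).2 = [seq Some (Some b) | b <- rgt s] ++ nseq j None
    & forall i, i < K ->
      scanned (T (ctape i)) :: (T (ctape i)).1
        = rcons (nseq (cnt s i) None) (Some None) /\
      all_blank (behead (T (ctape i)).2)].

Lemma ctape_neq0 i : i < K -> (ctape i == ord0) = false.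
Proof. by move=> iK; rewrite -val_eqE /= inordK. Qed.

Lemma ctape_eq i j : i < K -> j < K -> (ctape i == ctape j) = (i == j).
Proof. by move=> iK jK; rewrite -val_eqE /= !inordK. Qed.

Lemma scan_bit s T : represents s T ->
  view T ord0 = if rgt s is b :: _ then Some (Some b) else None.
Proof.
case=> _ [j e] _; rewrite ffunE /scanned e.
by case: (rgt s) => //=; case: j {e}.
Qed.

Lemma scan_counter s T i : represents s T -> i < K ->
  view T (ctape i) = if cnt s i == 0 then Some None else None.
Proof.
case=> _ _ H iK; rewrite ffunE; have [e _] := H i iK.
by case: (cnt s i) e => [|n] /= [-> _].
Qed.

Lemma testedE s T t : represents s T ->
  (if t is NonZero i then i < K else true) ->
  tested t (view T) = holds t s.
Proof.
move=> rT; case: t => [i iK|_|_] /=.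
- by rewrite (scan_counter rT iK); case: (cnt s i).
- by rewrite (scan_bit rT); case: (rgt s) => [|[]].
- by rewrite (scan_bit rT); case: (rgt s).
Qed.

(** Each step writes on all tapes, so that even a tape left alone may acquire an explicit blank. *)
Lemma represents_idle s T : represents s T ->
  represents s (perform (idle (view T)) T).
Proof.
move=> rT; have [e1 [j e2] H] := rT; split; rewrite ?perform_idle_view //=.
  have := scan_bit rT; rewrite ffunE => ->; rewrite e2.
  case: (rgt s) => [|b r] /=; last by exists j.
  by exists j.-1.+1; case: j {e2}.
move=> i iK; rewrite perform_idle_view /=; exact: H.
Qed.

Lemma perform_act_on j a (T : tapes) i :
  perform (act_on j a (view T)) T i =
    if i == j then @Defs.shift compiled a.2 (@write compiled a.1 (T i))
    else perform (idle (view T)) T i.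
Proof. by rewrite !ffunE /act_on; case: eqP. Qed.

Lemma represents_counter s T i m x : represents s T -> i < K ->
  let t := @Defs.shift compiled m (@write compiled (view T (ctape i)) (T (ctape i))) in
  scanned t :: t.1 = rcons (nseq x None) (Some None) ->
  all_blank (behead t.2) ->
  represents (Store (upd (cnt s) i x) (lft s) (rgt s))
    (perform (act_on (ctape i) (view T (ctape i), m) (view T)) T).
Proof.
move=> rT iK t e1 e2; have [h1 h2 h3] := represents_idle rT.
split; rewrite /= ?perform_act_on 1?eq_sym ?ctape_neq0 //.
move=> j jK; rewrite perform_act_on ctape_eq // /upd; case: eqP => [->|_] //.
exact: h3.
Qed.

Lemma represents_head s T a l r : represents s T ->
  let t := @Defs.shift compiled a.2 (@write compiled a.1 (T ord0)) in
  t.1 = [seq Some (Some b) | b <- l] ->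
  (exists j, t.2 = [seq Some (Some b) | b <- r] ++ nseq j None) ->
  represents (Store (cnt s) l r) (perform (act_on ord0 a (view T)) T).
Proof.
move=> rT t e1 e2; have [h1 h2 h3] := represents_idle rT.
split; rewrite /= ?perform_act_on ?eqxx //.
by move=> j jK; rewrite perform_act_on ctape_neq0 //; apply: h3.
Qed.

(** Elementary commands and tests take one machine step each and sequencing takes none, in agreement
    with the costs in [run]; the inequality only reflects [run_leq]. *)
Lemma simulation c s n s1 : run c s n s1 -> width c <= K ->
  forall T, represents s T -> exists n' T1,
    [/\ n' <= n, reach (entry c) T n' T1 & represents s1 T1].
Proof.
elim=> {c s n s1}.
- move=> i f l r iK T rT; do 2!eexists; split; [exact: leqnn| |].
    by apply: reach_exit.
  have [_ _ /(_ i iK) /= [e1 e2]] := rT.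
  apply: (represents_counter rT iK) => /=; rewrite ?ffunE /scanned /=.
    rewrite e1 /=; congr (_ :: _).
    by case: (behead _) e2 => [|x w] //= /andP[/eqP].
  by case: (behead _) e2 => [|x w] //= /andP[].
- move=> i f l r fi iK T rT; do 2!eexists; split; [exact: leqnn| |].
    by apply: reach_exit.
  have [_ _ /(_ i iK) /= [e1 e2]] := rT.
  apply: (represents_counter rT iK) => /=; rewrite ?ffunE /scanned /=.
    case: (f i) fi e1 => [|x] //= _ [_ ->].
    by case: x.
  case: (f i) fi e1 => [|x] //= _ [e _].
  by rewrite /scanned in e; rewrite e /=.
- move=> b f l r _ T rT; do 2!eexists; split; [exact: leqnn| |].
    by apply: reach_exit.
  have e0 := scan_bit rT; have [/= e1 [j e2] _] := rT.
  apply: (represents_head rT) => /=; rewrite e1 //=.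
  rewrite e0 e2 /=; case: r {rT e0 e2} => [|b' r] /=; last by exists j.
  by exists j.-1.+1; case: j.
- move=> b f l r _ T rT; do 2!eexists; split; [exact: leqnn| |].
    by apply: reach_exit.
  have e0 := scan_bit rT; have [/= e1 [j e2] _] := rT.
  apply: (represents_head rT) => /=; first by rewrite /scanned /= e0 e1.
  by rewrite e2 /=; exists j.
- move=> b b' f l r _ T rT; do 2!eexists; split; [exact: leqnn| |].
    by apply: reach_exit.
  have [/= e1 [j e2] _] := rT.
  by apply: (represents_head rT) => //=; rewrite e2 /=; exists j.
- move=> c d s n s1 m s2 _ IH1 _ IH2 /=; rewrite geq_max => /andP[w1 w2] T rT.
  have [n1 [T1 [le1 H1 rT1]]] := IH1 w1 T rT.
  have [n2 [T2 [le2 H2 rT2]]] := IH2 w2 T1 rT1.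
  exists (n1 + n2), T2; split => //; first exact: leq_add.
  exact: reach_seql H2.
- move=> t c d s n s1 _ IH /=; rewrite !geq_max => /and3P[wt w1 w2] T rT.
  have eT : tested t (view T) = holds t s by apply: testedE => //; case: (t) wt.
  have w : width (if holds t s then c else d) <= K by case: ifP.
  have [n1 [T1 [le1 H1 rT1]]] := IH w _ (represents_idle rT).
  exists n1.+1, T1; split => //.
  move: H1; case: ifP => h H1.
    refine (@reach_step (If t c d) None _ _ _ _ _ _ (reach_ifl t d H1)).
    by rewrite /= eT h.
  refine (@reach_step (If t c d) None _ _ _ _ _ _ (reach_ifr t c H1)).
  by rewrite /= eT h.
- move=> t c s ht /=; rewrite geq_max => /andP[wt w] T rT.
  have eT : tested t (view T) = holds t s by apply: testedE => //; case: (t) wt.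
  do 2!eexists; split; [exact: leqnn| |exact: represents_idle rT].
  by apply: reach_exit; rewrite /= eT (negPf ht).
- move=> t c s n s1 m s2 ht _ IH1 _ IH2 /= w T rT.
  have /andP[wt w1] : (if t is NonZero i then i < K else true) && (width c <= K).
    by move: w; rewrite geq_max; case: (t).
  have eT := testedE rT wt.
  have [n1 [T1 [le1 H1 rT1]]] := IH1 w1 _ (represents_idle rT).
  have [n2 [T2 [le2 H2 rT2]]] := IH2 w T1 rT1.
  exists (n1 + n2).+1, T2; split => //; first by rewrite ltnS leq_add.
  refine (@reach_step (While t c) None _ _ _ _ _ _ (reach_while H1 H2)).
  by rewrite /= eT ht.
- move=> c s n m s1 le _ IH w T rT; have [n' [T1 [le' H rT1]]] := IH w T rT.
  by exists n', T1; split => //; apply: leq_trans le.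
Qed.

Lemma iter_reach c (p : point c) (emb : option (point c) -> mstate) T n T1 :
  (forall p x, mtrans (emb (Some p)) x = (emb (next p x).1, (next p x).2)) ->
  (forall p, halting (emb (Some p) : state compiled) = false) ->
  reach p T n T1 ->
  iter n (@step compiled) (emb (Some p), T) = (emb None, T1).
Proof.
move=> emb_next emb_run; elim=> {p T n T1} [p T a e|p T p' a n T' e _ IH].
  by rewrite /= /step emb_run /= -/(view T) emb_next e.
by rewrite iterSr {2}/step emb_run /= -/(view T) emb_next e.
Qed.

Lemma iter_halting (T : nat) (cf : config compiled) : halting cf.1 ->
  iter T (@step compiled) cf = cf.
Proof. by move=> h; elim: T => //= T ->; rewrite /step h. Qed.

(** The two extra steps write the origin marks and read off the answer. *)
Lemma compiled_answers w n s m : width prog <= K -> out < K ->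
  run prog (Store (fun=> 0) [::] w) n s -> n + 2 <= m ->
  answers_within compiled w m (cnt s out == 0).
Proof.
move=> wK oK H le; set s0 := Store _ _ _ in H.
pose T0 : tapes := (init compiled w).2.
pose T1 : tapes := perform (mtrans (inr None) (view T0)).2 T0.
have rT1 : represents s0 T1.
  split => /=.
  - by rewrite !ffunE.
  - have vE : view T0 ord0 = head None [seq Some (Some b) | b <- w].
      by rewrite !ffunE.
    rewrite !ffunE /= vE; case: (w) => [|b w'].
      by exists 1.
    by exists 0; rewrite cats0.
  - move=> i iK; by rewrite !ffunE /= (ctape_neq0 iK).
have [n' [T2 [le' R rT2]]] := simulation H wK rT1.
pose emb (o : option (point prog)) : mstate :=
  if o is Some p then inl p else inr (Some None).
have e2 := @iter_reach prog (entry prog) emb T1 n' T2 _ _ R.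
have {}e2 : iter n' (@step compiled) (inl (entry prog), T1)
    = (inr (Some None), T2).
  by apply: e2 => // p x; rewrite /= /emb; case: (next p x) => [[]].
have e1 : @step compiled (init compiled w) = (inl (entry prog), T1) by [].
have e3 : @step compiled (inr (Some None), T2) =
    (inr (Some (Some (cnt s out == 0))), perform (idle (view T2)) T2).
  rewrite /step /= -/(view T2); congr (inr (Some (Some _)), _).
  have /= -> := testedE (t := NonZero out) rT2 oK.
  by rewrite negbK.
have -> : m = (m - (n' + 2)) + (1 + (n' + 1)).
  by lia.
have e4 : iter (1 + (n' + 1)) (@step compiled) (init compiled w) =
    (inr (Some (Some (cnt s out == 0))), perform (idle (view T2)) T2).
  by rewrite 2!iterD -e3 -e2 -e1.
by rewrite /answers_within iterD e4 iter_halting.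
Qed.

End Compiled.

End Compilation.

Lemma polytime_of_run (A : pred nat) (c : cmd) (out e : nat) :
  (forall n, exists s,
     run c (Store (fun=> 0) [::] (binary n)) ((size (binary n) + 2) ^ e) s /\
     A n = (cnt s out == 0)) ->
  polytime_decidable A.
Proof.
move=> H; pose K := maxn (width c) out.+1.
exists (compiled K c out), (3 ^ e + 2), e => n; have [s [R ->]] := H n.
apply: compiled_answers R _; rewrite ?leq_maxl ?leq_maxr //.
(* Even 0 has a digit, so that [size + 2] is at most three times the size. *)
have N0 : 0 < size (binary n) by rewrite size_rev size_mkseq.
rewrite mulnDl -expnMn leq_add //; last by rewrite leq_pmulr ?expn_gt0 ?N0.
case: (e) => // e'; rewrite leq_exp2r //; move: (size _) N0 => N N0; lia.
Qed.

(** * Polynomial-time evaluation of arithmetic expressions *)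

(** The base is at least 2 even for [V = 0], so that constants and sums can be absorbed by the
    exponent. *)
Definition poly_bounded (g : nat -> nat) : Prop :=
  exists d, forall V, g V <= (V + 2) ^ d.

Lemma poly_id : poly_bounded id.
Proof. by exists 1 => V; rewrite expn1 leq_addr. Qed.

Lemma poly_cst c : poly_bounded (fun=> c).
Proof.
exists c => V; apply: leq_trans (_ : 2 ^ c <= _); first exact/ltnW/ltn_expl.
by case: c => // c; rewrite leq_exp2r // leq_addl.
Qed.

Lemma poly_mul g h :
  poly_bounded g -> poly_bounded h -> poly_bounded (fun V => g V * h V).
Proof. by move=> [d H] [e G]; exists (d + e) => V; rewrite expnD leq_mul. Qed.

Lemma poly_add g h :
  poly_bounded g -> poly_bounded h -> poly_bounded (fun V => g V + h V).
Proof.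
move=> [d H] [e G]; exists (d + e).+1 => V.
have [Hd Ge] := (H V, G V); rewrite expnS.
apply: leq_trans (leq_add Hd Ge) _; rewrite expnD.
have: 0 < (V + 2) ^ d by rewrite expn_gt0 addn2.
have: 0 < (V + 2) ^ e by rewrite expn_gt0 addn2.
by move: (_ ^ d) (_ ^ e) => x y; nia.
Qed.

Lemma poly_comp g h :
  poly_bounded g -> poly_bounded h -> poly_bounded (fun V => g (h V)).
Proof.
move=> [d H] [e G]; exists ((e + 2) * d) => V.
apply: leq_trans (H _) _; rewrite expnM; case: d {H} => // d.
rewrite leq_exp2r // expnD; have := G V.
have: 0 < (V + 2) ^ e by rewrite expn_gt0 addn2.
by move: (_ ^ e) => x; rewrite !addn2 !expnS expn0; nia.
Qed.

Lemma poly_max g h :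
  poly_bounded g -> poly_bounded h -> poly_bounded (fun V => maxn (g V) (h V)).
Proof.
move=> Pg Ph; have [d H] := poly_add Pg Ph; exists d => V.
by apply: leq_trans (H V); rewrite geq_max leq_addl leq_addr.
Qed.

Lemma poly_exp g k : poly_bounded g -> poly_bounded (fun V => g V ^ k).
Proof.
move=> [d H]; exists (d * k) => V; rewrite expnM.
by case: k => // k; rewrite leq_exp2r.
Qed.

(** * Timed execution of programs that act on counters only *)

Definition calc (c : cmd) (f : nat -> nat) (n : nat) (f' : nat -> nat) : Prop :=
  forall l r, run c (Store f l r) n (Store f' l r).

Lemma calc_seq c d f n g m h :
  calc c f n g -> calc d g m h -> calc (Seq c d) f (n + m) h.
Proof. by move=> H1 H2 l r; apply: run_seq. Qed.

Lemma calc_leq c f n m g : n <= m -> calc c f n g -> calc c f m g.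
Proof. by move=> le H l r; apply: run_leq (le) _. Qed.

Lemma calc_ext c f n g g' : calc c f n g -> g =1 g' -> calc c f n g'.
Proof. by move=> H /funext <-. Qed.

Lemma calc_if i c d f n g :
  calc (if f i != 0 then c else d) f n g ->
  calc (If (NonZero i) c d) f n.+1 g.
Proof. by move=> H l r; apply: run_if => /=; case: ifP H => h H; apply: H. Qed.

Lemma calc_inc i f : calc (Inc i) f 1 (upd f i (f i).+1).
Proof. by move=> l r; apply: run_inc. Qed.

Lemma calc_dec i f : f i != 0 -> calc (Dec i) f 1 (upd f i (f i).-1).
Proof. by move=> H l r; apply: run_dec. Qed.

(** [F k] is the loop invariant, given as the whole content of the counters at the moment when
    counter [i] is tested with value [k]. *)
Lemma calc_loop i c (F : nat -> nat -> nat) T N :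
  (forall k, k <= N -> F k i = k) ->
  (forall k, k < N -> calc c (F k.+1) T (F k)) ->
  calc (While (NonZero i) c) (F N) (N * T.+1 + 1) (F 0).
Proof.
elim: N => [|N IH] HF H l r.
  by apply: run_while0; rewrite /= HF.
have -> : N.+1 * T.+1 + 1 = (T + (N * T.+1 + 1)).+1 by lia.
apply: run_whileS (H _ _ _ _) (IH _ _ _ _) => //=; first by rewrite HF.
  by move=> k kN; apply/HF/leqW.
by move=> k kN; apply/H/ltnW.
Qed.

Ltac upd_ext := let j := fresh "j" in
  intros; move=> j; rewrite /upd /=; repeat case: eqP => //=; intros; subst; try lia.

Definition Clear i := While (NonZero i) (Dec i).

Lemma calc_clear i f : calc (Clear i) f (f i * 2 + 1) (upd f i 0).
Proof.
have E : f = upd f i (f i) by apply/funext; upd_ext.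
rewrite {1}E; apply: (calc_loop (F := fun k => upd f i k)) => [k _|k _].
  by rewrite /upd eqxx.
by apply: calc_ext (calc_dec _) _; rewrite /upd ?eqxx //; upd_ext.
Qed.

Definition Move i j := While (NonZero i) (Seq (Dec i) (Inc j)).

Lemma calc_move i j f : i != j ->
  calc (Move i j) f (f i * 3 + 1) (upd (upd f j (f j + f i)) i 0).
Proof.
move=> ij; pose F k := upd (upd f j (f j + (f i - k))) i k.
have E : f = F (f i) by apply/funext; rewrite /F; upd_ext.
have E' : upd (upd f j (f j + f i)) i 0 = F 0.
  by apply/funext; rewrite /F; upd_ext.
rewrite {1}E E'; apply: calc_loop => [k _|k le]; first by rewrite /F /upd eqxx.
apply: (@calc_seq _ _ _ 1 _ 1); first by apply: calc_dec; rewrite /F /upd eqxx.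
by apply: calc_ext (calc_inc _ _) _; rewrite /F; move/eqP: ij => ij; upd_ext.
Qed.

Definition Copy i j t :=
  Seq (While (NonZero i) (Seq (Dec i) (Seq (Inc j) (Inc t)))) (Move t i).

Lemma calc_copy i j t f : i != j -> i != t -> j != t -> f t = 0 ->
  calc (Copy i j t) f (f i * 7 + 2) (upd f j (f j + f i)).
Proof.
move=> /eqP ij /eqP it /eqP jt t0.
pose F k := upd (upd (upd f j (f j + (f i - k))) i k) t (f i - k).
have E : f = F (f i) by apply/funext; rewrite /F; upd_ext.
have -> : f i * 7 + 2 = (f i * 4 + 1) + (F 0 t * 3 + 1).
  by rewrite /F /upd eqxx; lia.
apply: (@calc_seq _ _ _ _ (F 0)).
  rewrite {1}E; apply: calc_loop => [k _|k le].
    by rewrite /F; move/eqP: it; rewrite /upd eqxx => /negPf->.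
  apply: (@calc_seq _ _ _ 1 _ 2).
    by apply: calc_dec; rewrite /F; move/eqP: it; rewrite /upd eqxx => /negPf->.
  apply: (@calc_seq _ _ _ 1 _ 1); first exact: calc_inc.
  by apply: calc_ext (calc_inc _ _) _; rewrite /F; upd_ext.
have ti : t != i by apply/eqP => e; rewrite e in it.
by apply: calc_ext (calc_move _ ti) _; rewrite /F; upd_ext.
Qed.

(** Bounded sums are the only iteration: without an index they give products, with an index bounded
    quantifiers and bounded search. *)
Inductive expr :=
  | Var of nat
  | Cst of nat
  | Add of expr & expr
  | Sub of expr & expr
  | Sum of option nat & expr & expr.

Fixpoint ev (s : nat -> nat) (e : expr) : nat :=
  match e with
  | Var x => s x
  | Cst n => n
  | Add e1 e2 => ev s e1 + ev s e2
  | Sub e1 e2 => ev s e1 - ev s e2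
  | Sum x e1 e2 => \sum_(i < ev s e1) ev (if x is Some y then upd s y i else s) e2
  end.

Fixpoint Const b n := if n is n'.+1 then Seq (Const b n') (Inc b) else Clear b.

(* Adds the value of the expression to the zero counter [b], using counters
   above [b] as scratch space; [rho] locates the variables. *)
Fixpoint comp (rho : nat -> nat) (b : nat) (e : expr) : cmd :=
  match e with
  | Var x => Copy (rho x) b b.+1
  | Cst n => Const b n
  | Add e1 e2 => Seq (comp rho b e1) (Seq (comp rho b.+1 e2) (Move b.+1 b))
  | Sub e1 e2 => Seq (comp rho b e1) (Seq (comp rho b.+1 e2)
      (While (NonZero b.+1)
        (Seq (Dec b.+1) (If (NonZero b) (Dec b) (Clear b)))))
  | Sum x e1 e2 => Seq (comp rho b.+1 e1)
      (While (NonZero b.+1) (Seq (Dec b.+1)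
        (Seq (comp (if x is Some y then upd rho y b.+1 else rho) b.+2 e2)
             (Move b.+2 b))))
  end.

Lemma calc_const b n f : f b = 0 -> calc (Const b n) f n.+1 (upd f b n).
Proof.
move=> fb; elim: n => [|n IH].
  by have := @calc_clear b f; rewrite fb.
apply: calc_leq (calc_seq IH (calc_ext (calc_inc _ _) _)); first by rewrite addn1.
by upd_ext.
Qed.

(** [G] bounds the value along with the time because values control the loops of enclosing
    expressions. Uniformity in [rho] and [b] is what the induction needs: the body of a sum is
    compiled with its index relocated and its scratch counters higher up. *)
Definition compiles e G := forall rho b f V,
  (forall x, rho x < b) -> (forall j, b <= j -> f j = 0) ->
  (forall x, f (rho x) <= V) ->
  ev (f \o rho) e <= G V /\
  calc (comp rho b e) f (G V) (upd f b (ev (f \o rho) e)).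

Lemma comp_correct e : exists2 G, poly_bounded G & compiles e G.
Proof.
elim: e => [x|n|e1 [G1 P1 H1] e2 [G2 P2 H2]|e1 [G1 P1 H1] e2 [G2 P2 H2]
  |x e1 [G1 P1 H1] e2 [G2 P2 H2]].
- exists (fun V => V * 7 + 2).
    by apply: poly_add (poly_cst 2); apply: poly_mul (poly_cst 7); apply: poly_id.
  move=> rho b f V Hrho Hf HV /=; split; first by have := HV x; lia.
  have lt := Hrho x.
  have E : f b + f (rho x) = f (rho x) by rewrite Hf.
  rewrite -E; have HVx := HV x; apply: calc_leq (calc_copy _ _ _ _); try lia.
  exact: Hf.
- exists (fun=> n.+1); first exact: poly_cst.
  by move=> rho b f V _ Hf _; split=> //; apply: calc_const; apply: Hf.
- exists (fun V => G1 V + (G2 V + (G2 V * 3 + 1))).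
    by do !apply: poly_add => //; [apply: poly_mul => //|]; apply: poly_cst.
  move=> rho b f V Hrho Hf HV /=.
  have [le1 C1] := H1 _ _ _ _ Hrho Hf HV.
  set v1 := ev _ e1 in le1 C1 *; set f1 := upd f b v1 in C1.
  have E1 : f1 \o rho = f \o rho.
    by apply/funext => y /=; rewrite /f1 /upd; have := Hrho y; case: eqP => //; lia.
  have [|||le2 C2] := H2 rho b.+1 f1 V.
  + by move=> y; apply/ltnW/Hrho.
  + by move=> j lj; rewrite /f1 /upd; case: eqP => [|_]; [lia|apply: Hf; lia].
  + by move=> y; have := congr1 (fun g => g y) E1; rewrite /= => ->.
  rewrite E1 in le2 C2; set v2 := ev _ e2 in le2 C2 *.
  split; first by lia.
  apply: calc_seq C1 _; apply: calc_seq C2 _.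
  apply: calc_leq (calc_ext (calc_move _ _) _); rewrite ?/f1 /upd ?eqxx; try lia.
  by have := Hf b (leqnn _); have := Hf b.+1 (leqnSn _); upd_ext.
- exists (fun V => G1 V + (G2 V + (G2 V * 4 + 1))).
    by do !apply: poly_add => //; [apply: poly_mul => //|]; apply: poly_cst.
  move=> rho b f V Hrho Hf HV /=.
  have [le1 C1] := H1 _ _ _ _ Hrho Hf HV.
  set v1 := ev _ e1 in le1 C1 *; set f1 := upd f b v1 in C1.
  have E1 : f1 \o rho = f \o rho.
    by apply/funext => y /=; rewrite /f1 /upd; have := Hrho y; case: eqP => //; lia.
  have [|||le2 C2] := H2 rho b.+1 f1 V.
  + by move=> y; apply/ltnW/Hrho.
  + by move=> j lj; rewrite /f1 /upd; case: eqP => [|_]; [lia|apply: Hf; lia].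
  + by move=> y; have := congr1 (fun g => g y) E1; rewrite /= => ->.
  rewrite E1 in le2 C2; set v2 := ev _ e2 in le2 C2 *.
  split; first by lia.
  apply: calc_seq C1 _; apply: calc_seq C2 _.
  pose F k := upd (upd f b (v1 - (v2 - k))) b.+1 k.
  apply: calc_leq (_ : v2 * 4 + 1 <= _) _; first by lia.
  have -> : upd f1 b.+1 v2 = F v2 by apply/funext; rewrite /F /f1; upd_ext.
  have -> : upd f b (v1 - v2) = F 0.
    by apply/funext; rewrite /F; have := Hf b.+1 (leqnSn _); upd_ext.
  apply: calc_loop => [k _|k lk]; first by rewrite /F /upd eqxx.
  apply: (@calc_seq _ _ _ 1 _ 2); first by apply: calc_dec; rewrite /F /upd eqxx.
  apply: calc_if; case: ifP => h.
    apply: calc_ext (calc_dec h) _; move: h; rewrite /F /upd; upd_ext.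
  apply: calc_leq (calc_ext (calc_clear _ _) _); move: h; rewrite /F.
    by rewrite /upd => /eqP->.
  by move=> /eqP h; upd_ext; move: h; rewrite /upd; repeat case: eqP => //; lia.
(* The body sees one more variable, the index, which is below [G1 V]. *)
- pose W V := G1 V + V; exists (fun V => G1 V + (G1 V * (G2 (W V) * 4 + 3) + 1)).
    apply: poly_add => //; apply: poly_add; last exact: poly_cst.
    apply: poly_mul => //; apply: poly_add; last exact: poly_cst.
    apply: poly_mul; last exact: poly_cst.
    by apply: poly_comp => //; apply: poly_add => //; apply: poly_id.
  move=> rho b f V Hrho Hf HV /=.
  have [||le1 C1] := H1 rho b.+1 f V _ _ HV.
  + by move=> y; apply/ltnW/Hrho.
  + by move=> j lj; apply: Hf; lia.
  set v1 := ev _ e1 in le1 C1 *.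
  pose g i := ev (if x is Some y then upd (f \o rho) y i else f \o rho) e2.
  pose rho' := if x is Some y then upd rho y b.+1 else rho.
  (* The loop counter [b.+1] serves as the index itself; as it runs downwards, the terms are added
     from the last to the first. *)
  pose F k := upd (upd f b (\sum_(k <= i < v1) g i)) b.+1 k.
  have body k : k < v1 -> let h := upd (upd f b (\sum_(k.+1 <= i < v1) g i)) b.+1 k in
    g k <= G2 (W V) /\ calc (comp rho' b.+2 e2) h (G2 (W V)) (upd h b.+2 (g k)).
    move=> lk h.
    have E : h \o rho' = if x is Some y then upd (f \o rho) y k else f \o rho.
      apply/funext => z /=; rewrite /h /rho'; case: (x) => [y|]; rewrite /upd /=.
        case: (z == y); first by rewrite eqxx.
        by have := Hrho z; repeat case: eqP => //; lia.
      by have := Hrho z; repeat case: eqP => //; lia.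
    rewrite /g -E; apply: H2.
    + move=> z; rewrite /rho'; case: (x) => [y|]; rewrite /upd; have := Hrho z; last by lia.
      by case: eqP; lia.
    + by move=> j lj; rewrite /h /upd; repeat case: eqP; try lia; move=> *; apply: Hf; lia.
    + move=> z; have := congr1 (fun g => g z) E; rewrite /= => ->.
      have := HV z; rewrite /W /=; case: (x) => [y|] /=; rewrite ?/upd /=.
        by case: eqP; lia.
      by lia.
  have gle k : k < v1 -> g k <= G2 (W V) by move=> /body[].
  split.
    rewrite -/(g _); apply: leq_trans (_ : v1 * G2 (W V) <= _); last by nia.
    rewrite -[X in X * _]card_ord -sum_nat_const; apply: leq_sum => i _.
    exact: gle.
  apply: calc_seq C1 _.
  apply: calc_leq (_ : v1 * (G2 (W V) * 4 + 2).+1 + 1 <= _) _; first by nia.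
  have -> : upd f b.+1 v1 = F v1.
    by apply/funext; rewrite /F big_geq //; have := Hf b (leqnn _); upd_ext.
  have -> : upd f b (\sum_(i < v1) g i) = F 0.
    by apply/funext; rewrite /F big_mkord; have := Hf b.+1 (leqnSn _); upd_ext.
  apply: calc_loop => [k _|k lk]; first by rewrite /F /upd eqxx.
  have [le2 C2] := body k lk.
  have -> : G2 (W V) * 4 + 2 = 1 + (G2 (W V) + (G2 (W V) * 3 + 1)) by lia.
  apply: calc_seq; first by apply: calc_dec; rewrite /F /upd eqxx.
  have -> : upd (F k.+1) b.+1 (F k.+1 b.+1).-1
    = upd (upd f b (\sum_(k.+1 <= i < v1) g i)) b.+1 k.
    by apply/funext; rewrite /F; upd_ext.
  apply: calc_seq C2 _; apply: calc_leq (calc_ext (calc_move _ _) _); last first.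
  + rewrite /F [\sum_(k <= i < v1) _]big_ltn //.
    have := Hf b.+2 (leqW (leqnSn _)); upd_ext.
  + by lia.
  + by rewrite /upd eqxx; lia.
Qed.

(** * The set A and its decision procedure *)

(** For w < p, the last four conditions say that p divides none of w + 1, w + 3, 3 w + 1, which are
    factors of the sums of two elements of [coefs w]. *)
Definition good (p w : nat) : bool :=
  [&& ~~ [exists x : 'I_p, x * x %% p == w], w + 1 != p, w + 3 != p,
      3 * w + 1 != p & 3 * w + 1 != 2 * p].

Definition param (p : nat) : nat := find (good p) (iota 0 p).

Definition coefs (w : nat) : seq nat := [:: 2 * w; w * w + w; w + 1].

Definition block (p u v : nat) : bool :=
  has (fun a => has (fun e => v + e == a * (u * u) %[mod p]) [:: 0; 1])
    (coefs (param p)).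

(* Reads [n] in mixed radix, with two digits [u], [v] in base [p] for each prime
   [p] among the [k] numbers from [q] on; all blocks but the last nonzero one
   are restricted. *)
Fixpoint accepted (k q n : nat) : bool :=
  if k is k'.+1 then
    if prime q then
      let n' := n %/ q %/ q in
      ((n' == 0) || block q (n %% q) (n %/ q %% q)) && accepted k' q.+1 n'
    else accepted k' q.+1 n
  else true.

(** Enough numbers from 11 on for their primes to cover all n < 2^N; the constants are explained at
    [weight_large]. *)
Definition fuel (N : nat) : nat := 8 * (N + 8) ^ 2.

(** * Arithmetic predicates as expressions with bounded sums *)

Definition notE a := Sub (Cst 1) a.
Definition boolE a := notE (notE a).
Definition leqE a b := notE (Sub a b).
Definition eqE a b := notE (Add (Sub a b) (Sub b a)).
Definition mulE a b := Sum None a b.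
Definition exE x n e := boolE (Sum (Some x) n e).

Lemma ev_not s a : ev s (notE a) = (ev s a == 0).
Proof. by rewrite /=; case: (ev s a). Qed.

Lemma ev_bool s a : ev s (boolE a) = (ev s a != 0).
Proof. by rewrite !ev_not; case: (ev s a). Qed.

Lemma ev_leq s a b : ev s (leqE a b) = (ev s a <= ev s b).
Proof. by rewrite ev_not. Qed.

Lemma ev_eq s a b : ev s (eqE a b) = (ev s a == ev s b).
Proof. by rewrite ev_not /= addn_eq0 !subn_eq0 eqn_leq. Qed.

Lemma ev_mul s a b : ev s (mulE a b) = ev s a * ev s b.
Proof. by rewrite /= sum_nat_const card_ord. Qed.

Lemma ev_ex s x n e :
  ev s (exE x n e) = [exists i : 'I_(ev s n), ev (upd s x i) e != 0].
Proof.
by rewrite ev_bool /= sum_nat_eq0 negb_forall.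
Qed.

Lemma ev_add s a b : ev s (Add a b) = ev s a + ev s b. Proof. by []. Qed.
Lemma ev_sub s a b : ev s (Sub a b) = ev s a - ev s b. Proof. by []. Qed.
Lemma ev_var s x : ev s (Var x) = s x. Proof. by []. Qed.
Lemma ev_cst s n : ev s (Cst n) = n. Proof. by []. Qed.

Definition evE :=
  (ev_not, ev_bool, ev_leq, ev_eq, ev_mul, ev_ex, ev_add, ev_sub, ev_var, ev_cst).

Definition primeE := notE (exE 20 (Var 0) (exE 21 (Var 0)
  (eqE (mulE (Var 20) (Var 21)) (Var 0)))).

Lemma ev_prime s : 1 < s 0 -> ev s primeE = prime (s 0).
Proof.
move=> q1; rewrite /primeE !evE; congr (nat_of_bool _).
rewrite eqb0; apply/idP/idP => [H|/primeP[_ pr]].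
  apply/primeP; split => // d dq; rewrite -implyNb.
  apply/implyP => d1; apply/negPn/negP => dNq.
  have d0 : 0 < d by apply: dvdn_gt0 dq; lia.
  have dlt : d < s 0 by rewrite ltn_neqAle dNq dvdn_leq //; lia.
  have elt : s 0 %/ d < s 0 by rewrite ltn_Pdiv //; lia.
  move/negP: H; apply; apply/existsP; exists (Ordinal dlt).
  rewrite !evE eqb0 negbK; apply/existsP; exists (Ordinal elt).
  by rewrite !evE eqb0 negbK /upd /= mulnC divnK.
apply/negP => /existsP[[a alt]]; rewrite !evE eqb0 negbK => /existsP[[b blt]].
rewrite !evE eqb0 negbK; rewrite /upd /= in blt * => /eqP e.
have /pr : a %| s 0 by rewrite -e dvdn_mulr.
case/orP => /eqP a1; last by lia.
by rewrite a1 mul1n in e; lia.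
Qed.

Definition squareE := exE 20 (Var 0) (exE 21 (Var 0)
  (eqE (mulE (Var 20) (Var 20)) (Add (mulE (Var 21) (Var 0)) (Var 22)))).

Lemma ev_square s : s 22 < s 0 ->
  ev s squareE = [exists x : 'I_(s 0), x * x %% s 0 == s 22].
Proof.
move=> lt; rewrite /squareE !evE; congr (nat_of_bool _).
apply: eq_existsb => x; rewrite !evE eqb0 negbK.
apply/existsP/eqP => [[k]|e].
  by rewrite !evE eqb0 negbK /upd /= => /eqP->; rewrite modnMDl modn_small.
have xlt := ltn_ord x.
have klt : x * x %/ s 0 < s 0 by rewrite ltn_divLR; nia.
by exists (Ordinal klt); rewrite !evE eqb0 negbK /upd /= {1}(divn_eq (x * x) (s 0)) e.
Qed.

Definition goodE :=
  let ne a b := notE (eqE a b) in let w := Var 22 in let q := Var 0 in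
  let w3 := Add (Add w w) (Add w (Cst 1)) in
  mulE (notE squareE) (mulE (ne (Add w (Cst 1)) q) (mulE (ne (Add w (Cst 3)) q)
    (mulE (ne w3 q) (ne w3 (Add q q))))).

Lemma ev_good s : s 22 < s 0 -> ev s goodE = good (s 0) (s 22).
Proof.
move=> lt; rewrite /goodE /good ev_mul ev_not ev_square // !evE !mulnb !eqb0.
congr (nat_of_bool _); do !congr (_ && _); congr (_ != _); lia.
Qed.

Definition paramE := Sum (Some 23) (Var 0)
  (notE (exE 22 (Add (Var 23) (Cst 1)) goodE)).

(** The first witness is found by counting the initial segments that contain none, which makes the
    search a bounded sum. *)
Lemma find_iota_sum (P : pred nat) n :
  find P (iota 0 n) = \sum_(i < n) ~~ [exists j : 'I_i.+1, P j].
Proof.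
elim: n => [|n IH]; first by rewrite big_ord0.
rewrite big_ord_recr [RHS]/= -IH -[n.+1 in LHS]addn1 iotaD find_cat size_iota /= add0n.
have -> : [exists j : 'I_n.+1, P j] = has P (iota 0 n) || P n.
  apply/existsP/orP => [[j Pj]|[/hasP[i]|Pn]].
  - have := ltn_ord j; rewrite ltnS leq_eqVlt => /orP[/eqP e|lt].
      by right; rewrite -e.
    by left; apply/hasP; exists (val j) => //; rewrite mem_iota.
  - rewrite mem_iota /= => lt Pi.
    by exists (Ordinal (ltnW lt : i < n.+1)).
  by exists ord_max.
case: ifP => h /=; first by rewrite addn0.
have -> : find P (iota 0 n) = n by rewrite hasNfind ?h // size_iota.
by case: (P n); rewrite ?addn0 ?addn1.
Qed.

Lemma ev_param s : ev s paramE = param (s 0).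
Proof.
rewrite /param find_iota_sum [LHS]/=; apply: eq_bigr => i _.
rewrite -[LHS]/(ev (upd s 23 i) (notE (exE 22 (Add (Var 23) (Cst 1)) goodE))).
rewrite ev_not ev_ex eqb0; congr (nat_of_bool (~~ _)).
have -> : ev (upd s 23 i) (Add (Var 23) (Cst 1)) = i.+1 by rewrite /= addn1.
apply: eq_existsb => j; rewrite ev_good ?eqb0 ?negbK //.
exact: leq_trans (ltn_ord j) (ltn_ord i).
Qed.

(** Adding p on the right makes the difference to x nonnegative, so that one natural multiplier k is
    enough. *)
Lemma exists_eq_mod p x y : 0 < p -> x <= p ->
  [exists k : 'I_(y + 2), x + k * p == y + p] = (x == y %[mod p]).
Proof.
move=> p0 xp; apply/existsP/eqP => [[k /eqP e]|e].
  by rewrite -(modnDr y) -e addnC modnMDl.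
have h : y + p = x + (y + p - x) by lia.
have d : p %| y + p - x by rewrite -eqn_mod_dvd ?modnDr; [apply/eqP|lia].
have lt : (y + p - x) %/ p < y + 2.
  by rewrite ltn_divLR //; nia.
by exists (Ordinal lt); rewrite /= divnK // -h.
Qed.

Definition congE a e := let y := mulE a (mulE (Var 1) (Var 1)) in
  exE 20 (Add y (Cst 2))
    (eqE (Add (Add (Var 2) (Cst e)) (mulE (Var 20) (Var 0))) (Add y (Var 0))).

Lemma ev_cong s a e : s 2 < s 0 -> e <= 1 ->
  (forall k, ev (upd s 20 k) a = ev s a) ->
  ev s (congE a e) = (s 2 + e == ev s a * (s 1 * s 1) %[mod s 0]).
Proof.
move=> lt e1 Ha; rewrite /congE !evE -exists_eq_mod; try lia.
congr (nat_of_bool _); apply: eq_existsb => k.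
by rewrite !evE eqb0 negbK Ha /upd.
Qed.

Definition blockE :=
  let w := Var 9 in let d a := Add (congE a 0) (congE a 1) in
  boolE (Add (d (Add w w)) (Add (d (Add (mulE w w) w)) (d (Add w (Cst 1))))).

Lemma ev_block s : s 2 < s 0 -> s 9 = param (s 0) ->
  ev s blockE = block (s 0) (s 1) (s 2).
Proof.
move=> lt e; rewrite /blockE ev_bool 5!ev_add.
rewrite !ev_cong //.
rewrite !evE /block /coefs -e /= !orbF !addn0 addnn -mul2n.
by do 6!case: (_ == _ %[mod _]).
Qed.

(** Counters 0, 1, 2 hold q, u, v; 3 tells whether the last quotient is nonzero, 4 whether n has
    been rejected; 5 is the position of the head; 6 is the bit read, 7 the quotient bit or the
    primality of q; 8 counts the rounds left, 9 holds w, 10 the remainder. Scratch counters start at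
    11. Variables 20 to 23 only index sums and are located by [comp]. *)
Definition vars := 11.

Definition slot (x : nat) := if x < vars then x else 0.

(** The value is formed in a scratch counter first, since [e] may mention the target. *)
Definition Asg a e := Seq (comp slot vars e) (Seq (Clear a) (Move vars a)).

Local Notation st l L R := (Store (nth 0 l) L R).

(** Describing the counters by a list of length [vars] with default 0 also records that all scratch
    counters are zero before and after. *)
Lemma asg_run a e : a < vars -> exists2 G, poly_bounded G &
  forall l l' V L R, size l = vars -> all (geq V) l ->
    l' = set_nth 0 l a (ev (nth 0 l \o slot) e) ->
    run (Asg a e) (st l L R) (G V) (st l' L R).
Proof.
move=> av; have [G P H] := comp_correct e.
exists (fun V => G V + ((V * 2 + 1) + (G V * 3 + 1))).
  have P1 := poly_cst 1.
  apply: poly_add (P) _; apply: poly_add; apply: poly_add (P1);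
    by apply: poly_mul (poly_cst _) => //; apply: poly_id.
move=> l l' V L R sl lV ->.
have Hl i : nth 0 l i <= V.
  case: (ltnP i (size l)) => h; last by rewrite nth_default.
  by have /allP/(_ _ (mem_nth 0 h)) := lV.
have Hs x : slot x < vars by rewrite /slot; case: ifP.
have [|le C] := H slot vars (nth 0 l) V Hs _ (fun x => Hl _).
  by move=> j h; rewrite nth_default // sl.
set v := ev _ e in le C *; set f := upd _ _ v in C.
have fv : f vars = v by rewrite /f /upd eqxx.
have fa : f a = nth 0 l a by rewrite /f /upd ltn_eqF.
apply: run_seq (C _ _) _; apply: run_seq.
  by apply: calc_leq (calc_clear a f) _ _; rewrite fa leq_add2r leq_mul.
have va : vars != a by rewrite gtn_eqF.
apply: calc_leq (calc_ext (calc_move (upd f a 0) va) _) _ _.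
  by rewrite /upd (negPf va) fv; lia.
move=> j; rewrite nth_set_nth /= /f /upd !eqxx (negPf va) add0n.
case: (j =P vars) => [->|_]; last by case: eqP.
by rewrite (negPf va) nth_default // sl.
Qed.

(** * Long division of a binary numeral on the tape *)

Fixpoint quotient (q r : nat) (w : bitseq) : bitseq :=
  if w is b :: w' then
    let t := r + r + b in let c := q <= t in c :: quotient q (t - c * q) w'
  else [::].

Fixpoint remainder (q r : nat) (w : bitseq) : nat :=
  if w is b :: w' then
    let t := r + r + b in let c := q <= t in remainder q (t - c * q) w'
  else r.

Definition value := foldl (fun r (b : bool) => r + r + b) 0.

Lemma size_quotient q r w : size (quotient q r w) = size w.
Proof. by elim: w r => //= b w IH r; rewrite IH. Qed.

Lemma long_division q w : 0 < q ->
  value (quotient q 0 w) = value w %/ q /\ remainder q 0 w = value w %% q.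
Proof.
move=> q0; rewrite /value; set f := fun _ _ => _.
(* Generalized to a division under way, where the digits read so far have quotient [a] and remainder
   [r]. *)
suff H a r : r < q ->
    foldl f a (quotient q r w) = foldl f (a * q + r) w %/ q /\
    remainder q r w = foldl f (a * q + r) w %% q.
  by have := H 0 0 q0.
elim: w a r => [|b w IH] a r rq /=.
  by rewrite divnMDl // divn_small // addn0 modnMDl modn_small.
have b1 : b <= 1 := leq_b1 b.
have [|-> ->] := IH (f a (q <= r + r + b)) (r + r + b - (q <= r + r + b) * q).
  by case: leqP => /=; lia.
suff -> : f a (q <= r + r + b) * q + (r + r + b - (q <= r + r + b) * q)
    = f (a * q + r) b by [].
by rewrite /f; case: leqP => /=; nia.
Qed.

Lemma value_eq0 w : (value w == 0) = ~~ has id w.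
Proof.
rewrite /value; set f := fun _ _ => _.
suff H a : (foldl f a w == 0) = (a == 0) && ~~ has id w by rewrite H.
elim: w a => [|b w IH] a /=; first by rewrite andbT.
by rewrite IH /f negb_or andbA; congr (_ && _); case: b; lia.
Qed.

Definition divide_step :=
  Seq (If IsOne (Asg 6 (Cst 1)) (Asg 6 (Cst 0)))
  (Seq (Asg 10 (Add (Add (Var 10) (Var 10)) (Var 6)))
  (Seq (Asg 7 (leqE (Var 0) (Var 10)))
  (Seq (Asg 10 (Sub (Var 10) (mulE (Var 7) (Var 0))))
  (Seq (Asg 3 (boolE (Add (Var 3) (Var 7))))
  (Seq (If (NonZero 7) (Put true) (Put false)) (Seq GoRight (Inc 5))))))).

Definition rewind := While (NonZero 5) (Seq (Dec 5) GoLeft).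

Definition divide :=
  Seq (Asg 10 (Cst 0)) (Seq (Asg 3 (Cst 0))
    (Seq (While NotBlank divide_step) rewind)).

Ltac bound := rewrite /=; repeat (apply/andP; split); rewrite //=; lia.

Lemma divide_step_run : exists2 G, poly_bounded G &
  forall q u v z j p bt qb c w r V (b : bool) L R,
    all (geq V) [:: q; u; v; z; j; p; bt; qb; c; w; r] -> r < q -> z <= 1 ->
    let t := r + r + b in let d := q <= t in
    run divide_step (st [:: q; u; v; z; j; p; bt; qb; c; w; r] L (b :: R)) (G V)
      (st [:: q; u; v; nat_of_bool ((z != 0) || d); j; p.+1; nat_of_bool b;
              nat_of_bool d; c; w; t - d * q] (d :: L) R).
Proof.
have [G1 P1 H1] := @asg_run 6 (Cst 1) isT.
have [G2 P2 H2] := @asg_run 6 (Cst 0) isT.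
have [G3 P3 H3] := @asg_run 10 (Add (Add (Var 10) (Var 10)) (Var 6)) isT.
have [G4 P4 H4] := @asg_run 7 (leqE (Var 0) (Var 10)) isT.
have [G5 P5 H5] := @asg_run 10 (Sub (Var 10) (mulE (Var 7) (Var 0))) isT.
have [G6 P6 H6] := @asg_run 3 (boolE (Add (Var 3) (Var 7))) isT.
have Pc := poly_cst; have Pi := poly_id.
(* Doubling the remainder and adding a bit may lead from V to 2 V + 1. *)
pose W V := V * 2 + 2.
have PW : poly_bounded W by apply: poly_add (Pc 2); apply: poly_mul.
exists (fun V => (G1 (W V) + G2 (W V) + 1) + (G3 (W V) + (G4 (W V) +
    (G5 (W V) + (G6 (W V) + (2 + (1 + 1))))))).
  by do !apply: poly_add => //; apply: poly_comp.
move=> q u v z j p bt qb c w r V b L R /= /andP[? /and5P[? ? ? ? /and5P[? ? ? ? /and3P[? ? _]]]] rq z1.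
set t := r + r + b; set d := q <= t.
have b1 : b <= 1 := leq_b1 b; have d1 : d <= 1 := leq_b1 d.
have tV : t <= V * 2 + 1 by rewrite /t; lia.
have [W1 W2] : V <= W V /\ V * 2 + 2 <= W V by rewrite /W; lia.
apply: (run_seq (s1 := st [:: q; u; v; z; j; p; nat_of_bool b; qb; c; w; r] L (b :: R))).
  rewrite addn1; apply: run_if; rewrite /=; case: (b).
    apply: (run_leq (leq_addr _ _)); by apply: H1 => //; bound.
  apply: (run_leq (leq_addl _ _)); by apply: H2 => //; bound.
apply: (run_seq (s1 := st [:: q; u; v; z; j; p; nat_of_bool b; qb; c; w; t] L (b :: R))).
  by apply: H3 => //; bound.
apply: (run_seq (s1 := st [:: q; u; v; z; j; p; nat_of_bool b; nat_of_bool d; c; w; t] L (b :: R))).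
  by apply: H4; rewrite ?ev_leq //; bound.
apply: (run_seq (s1 := st [:: q; u; v; z; j; p; nat_of_bool b; nat_of_bool d; c; w; t - d * q] L (b :: R))).
  by apply: H5; rewrite ?ev_sub ?ev_mul //; bound.
apply: (run_seq (s1 := st [:: q; u; v; nat_of_bool ((z != 0) || d); j; p; nat_of_bool b; nat_of_bool d; c; w; t - d * q] L (b :: R))).
  apply: H6; rewrite ?ev_bool //; first by bound.
  by rewrite /= addn_eq0 negb_and /=; case: (d).
apply: (run_seq (s1 := st [:: q; u; v; nat_of_bool ((z != 0) || d); j; p; nat_of_bool b; nat_of_bool d; c; w; t - d * q] L (d :: R))).
  by apply: run_if; rewrite /=; case: (d) => /=; apply: run_put.
apply: run_seq (run_right _ _ _ _) _.
apply: calc_ext (calc_inc _ _) _ _ _ => i.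
by rewrite /upd; do 11!case: i => [|i] //=.
Qed.

Lemma divide_loop_run : exists2 G, poly_bounded G &
  forall R q u v z j p bt qb c w r V L,
    all (geq V) [:: q; u; v; z; j; p; bt; qb; c; w; r] -> r < q ->
    z <= 1 -> bt <= 1 -> qb <= 1 -> p + size R <= V -> 0 < V ->
    exists bt' qb', [/\ bt' <= 1, qb' <= 1 &
    run (While NotBlank divide_step)
      (st [:: q; u; v; z; j; p; bt; qb; c; w; r] L R) (size R * (G V).+1 + 1)
      (st [:: q; u; v; nat_of_bool ((z != 0) || has id (quotient q r R)); j;
              p + size R; bt'; qb'; c; w; remainder q r R]
         (rev (quotient q r R) ++ L) [::])].
Proof.
have [G P H] := divide_step_run; exists G => //.
elim=> [|b R IH] q u v z j p bt qb c w r V L lV rq z1 bt1 qb1 pV V0.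
  exists bt, qb; split => //=; rewrite orbF addn0.
  have -> : nat_of_bool (z != 0) = z by case: z z1 {lV} => [|[]].
  exact: run_while0.
have S := H _ _ _ _ _ _ _ _ _ _ _ _ b L R lV rq z1.
set t := r + r + b in S; set d := q <= t in S.
have b1 : b <= 1 := leq_b1 b; have d1 : d <= 1 := leq_b1 d.
rewrite /= in pV; move: lV => /= /andP[? /and5P[? ? ? ? /and5P[? ? ? ? /and3P[? ? _]]]].
have tq : t - d * q < q by rewrite /d /t; case: leqP => /=; lia.
have z'1 := leq_b1 ((z != 0) || d).
have [|||||bt' [qb' [bt'1 qb'1 S']]] :=
  IH q u v (nat_of_bool ((z != 0) || d)) j p.+1 b d c w (t - d * q) V (d :: L) _ tq z'1 => //.
- bound.
- by lia.
exists bt', qb'; split=> //.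
rewrite [size _]/= mulSn addSn addSn -addnA; apply: run_whileS S _ => //.
move: S'; rewrite /= -/t -/d rev_cons cat_rcons (_ : p + (size R).+1 = p.+1 + size R); last by lia.
have -> (x : bool) : (nat_of_bool x != 0) = x by case: x.
by rewrite -orbA.
Qed.

Lemma rewind_run p q u v z j bt qb c w r L R : size L = p ->
  run rewind (st [:: q; u; v; z; j; p; bt; qb; c; w; r] L R) (p * 3 + 1)
    (st [:: q; u; v; z; j; 0; bt; qb; c; w; r] [::] (catrev L R)).
Proof.
elim: L p R => [|b L IH] p R /= <-; first exact: run_while0.
rewrite mulSn addSn addSn; apply: (run_whileS (n := 2)); rewrite //=; last exact: IH.
rewrite -[2]/(1 + 1); apply: run_seq; last exact: run_left.
apply: calc_ext (calc_dec _) _ _ _ => // i.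
by rewrite /upd; do 11!case: i => [|i] //=.
Qed.

Lemma divide_run : exists2 G, poly_bounded G &
  forall q u v z j bt qb c w r V R,
    all (geq V) [:: q; u; v; z; j; 0; bt; qb; c; w; r] -> 0 < q ->
    bt <= 1 -> qb <= 1 -> size R <= V ->
    exists bt' qb' R', [/\ bt' <= 1, qb' <= 1, size R' = size R,
      value R' = value R %/ q &
    run divide (st [:: q; u; v; z; j; 0; bt; qb; c; w; r] [::] R) (G V)
      (st [:: q; u; v; nat_of_bool (value R' != 0); j; 0; bt'; qb'; c; w;
              value R %% q] [::] R')].
Proof.
have [G1 P1 H1] := @asg_run 10 (Cst 0) isT.
have [G2 P2 H2] := @asg_run 3 (Cst 0) isT.
have [G3 P3 H3] := divide_loop_run.
have Pc := poly_cst; have Pi := poly_id.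
exists (fun V => G1 V + (G2 V + ((V * (G3 V + 1) + 1) + (V * 3 + 1)))).
  by do !apply: poly_add => //; apply: poly_mul => //; apply: poly_add.
move=> q u v z j bt qb c w r V R lV q0 bt1 qb1 sR.
move: (lV) => /= /andP[? /and5P[? ? ? ? /and5P[? ? ? ? /andP[? _]]]].
have [||bt' [qb' [bt'1 qb'1 S]]] :=
  H3 R q u v 0 j 0 bt qb c w 0 V [::] _ q0 isT bt1 qb1 sR; [bound|lia|].
have [vq vr] := long_division R q0.
exists bt', qb', (quotient q 0 R); split => //; first exact: size_quotient.
apply: run_seq (H1 _ [:: q; u; v; z; j; 0; bt; qb; c; w; 0] _ _ _ _ _ _) _ => //.
apply: run_seq (H2 _ [:: q; u; v; 0; j; 0; bt; qb; c; w; 0] _ _ _ _ _ _) _ => //.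
  by bound.
apply: (run_seq (n := V * (G3 V + 1) + 1)).
  by apply: run_leq S; rewrite leq_add2r addn1 leq_mul2r sR orbT.
rewrite cats0 orFb add0n value_eq0 negbK vr.
apply: (run_leq (n := size R * 3 + 1)); first by rewrite leq_add2r leq_mul2r sR orbT.
have := @rewind_run (size R) q u v (has id (quotient q 0 R)) j bt' qb' c w
  (value R %% q) (rev (quotient q 0 R)) [::].
by rewrite size_rev size_quotient [catrev _ _]revK; apply.
Qed.

(** After the second division counter 3 tells whether anything is left above this block, that is,
    whether the block is restricted. *)
Definition block_step :=
  Seq divide (Seq (Asg 1 (Var 10)) (Seq divide (Seq (Asg 2 (Var 10))
    (Seq (Asg 9 paramE)
      (Asg 4 (boolE (Add (Var 4) (mulE (Var 3) (notE blockE))))))))).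

Lemma param_leq q : param q <= q.
Proof. by rewrite -[leqRHS](size_iota 0) find_size. Qed.

Lemma block_step_run : exists2 G, poly_bounded G &
  forall q u v z j bt qb c w r V R,
    all (geq V) [:: q; u; v; z; j; 0; bt; qb; c; w; r] -> 0 < q ->
    bt <= 1 -> qb <= 1 -> size R <= V ->
    exists u' v' z' bt' qb' w' r' R' (j' := nat_of_bool ((j != 0) ||
      ~~ ((value R' == 0) || block q (value R %% q) (value R %/ q %% q)))),
    [/\ all (geq V) [:: q; u'; v'; z'; j'; 0; bt'; qb'; c; w'; r'],
      (bt' <= 1) && (qb' <= 1), size R' = size R,
      value R' = value R %/ q %/ q &
    run block_step (st [:: q; u; v; z; j; 0; bt; qb; c; w; r] [::] R) (G V)
      (st [:: q; u'; v'; z'; j'; 0; bt'; qb'; c; w'; r'] [::] R')].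
Proof.
have [G0 P0 H0] := divide_run.
have [G1 P1 H1] := @asg_run 1 (Var 10) isT.
have [G2 P2 H2] := @asg_run 2 (Var 10) isT.
have [G3 P3 H3] := @asg_run 9 paramE isT.
have [G4 P4 H4] :=
  @asg_run 4 (boolE (Add (Var 4) (mulE (Var 3) (notE blockE)))) isT.
exists (fun V => G0 V + (G1 V + (G0 V + (G2 V + (G3 V + G4 V))))).
  by do !apply: poly_add.
move=> q u v z j bt qb c w r V R lV q0 bt1 qb1 sR.
move: (lV) => /= /andP[? /and5P[? ? ? ? /and5P[? ? ? ? /andP[? _]]]].
have [bt' [qb' [R' [bt'1 qb'1 sR' vR' S]]]] := H0 _ _ _ _ _ _ _ _ _ _ _ _ lV q0 bt1 qb1 sR.
set u' := value R %% q in S; set z' := nat_of_bool (value R' != 0) in S.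
have u'q : u' < q by rewrite ltn_mod.
have z'1 : z' <= 1 := leq_b1 _.
have l2V : all (geq V) [:: q; u'; v; z'; j; 0; bt'; qb'; c; w; u'] by bound.
have sR2 : size R' <= V by rewrite sR'.
have [bt2 [qb2 [R2 [bt21 qb21 sR2' vR2 S2]]]] := H0 _ _ _ _ _ _ _ _ _ _ _ _ l2V q0 bt'1 qb'1 sR2.

set v' := value R' %% q in S2; set z2 := nat_of_bool (value R2 != 0) in S2.
have v'q : v' < q by rewrite ltn_mod.
have z21 : z2 <= 1 := leq_b1 _.
have wq := param_leq q.
exists u', v', z2, bt2, qb2, (param q), v', R2.
set j' := nat_of_bool ((j != 0) || _).
have j'1 : j' <= 1 := leq_b1 _.
split; [by bound|by rewrite bt21|by rewrite sR2'|by rewrite vR2 vR'|].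
apply: run_seq S _.
apply: run_seq (H1 _ [:: q; u'; v; z'; j; 0; bt'; qb'; c; w; u'] _ _ _ _ _ _) _ => //.
  by bound.
apply: run_seq S2 _.
apply: run_seq (H2 _ [:: q; u'; v'; z2; j; 0; bt2; qb2; c; w; v'] _ _ _ _ _ _) _ => //.
  by bound.
apply: run_seq (H3 _ [:: q; u'; v'; z2; j; 0; bt2; qb2; c; param q; v'] _ _ _ _ _ _) _ => //.
- by bound.
- by rewrite ev_param.
apply: H4 => //; first by bound.
rewrite ev_bool ev_add ev_mul ev_not ev_block //= /j' -vR' -/u' -/v' /z2.
by case: (j) => [|?]; case: (value R2 == 0); case: (block _ _ _).
Qed.

(** * The loop over the candidates for a prime, and the whole program *)

Definition round :=
  Seq (Asg 7 primeE) (Seq (If (NonZero 7) block_step (Asg 7 (Cst 0))) (Inc 0)).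

Lemma rounds_run : exists2 G, poly_bounded G &
  forall k q u v z j bt qb w r V R,
    all (geq V) [:: q; u; v; z; j; 0; bt; qb; k; w; r] -> 1 < q -> q + k <= V ->
    bt <= 1 -> qb <= 1 -> size R <= V ->
    exists s, run (While (NonZero 8) (Seq (Dec 8) round))
        (st [:: q; u; v; z; j; 0; bt; qb; k; w; r] [::] R) (k * (G V).+1 + 1) s /\
      (cnt s 4 == 0) = (j == 0) && accepted k q (value R).
Proof.
have [G0 P0 H0] := block_step_run.
have [G1 P1 H1] := @asg_run 7 primeE isT.
have [G2 P2 H2] := @asg_run 7 (Cst 0) isT.
have Pc := poly_cst.
exists (fun V => 1 + (G1 V + ((G0 V + G2 V + 1) + 1))).
  by do !apply: poly_add.
elim=> [|k IH] q u v z j bt qb w r V R lV q1 qk bt1 qb1 sR.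
  by eexists; split; [exact: run_while0|rewrite /= andbT].
move: (lV) => /= /andP[? /and5P[? ? ? ? /and5P[? ? ? ? /andP[? _]]]].
set T := 1 + (_ + _).
(* One round, in a form common to prime and composite [q]: the rejection flag together with the test
   still to be made keeps its truth value. *)
suff [u' [v' [z' [j' [bt' [qb' [w' [r' [R' []]]]]]]]]] :
  exists u' v' z' j' bt' qb' w' r' R',
    [/\ all (geq V) [:: q.+1; u'; v'; z'; j'; 0; bt'; qb'; k; w'; r'],
      (bt' <= 1) && (qb' <= 1), size R' = size R,
      (j' == 0) && accepted k q.+1 (value R') =
      (j == 0) && accepted k.+1 q (value R) &
    run (Seq (Dec 8) round)
      (st [:: q; u; v; z; j; 0; bt; qb; k.+1; w; r] [::] R) T
      (st [:: q.+1; u'; v'; z'; j'; 0; bt'; qb'; k; w'; r'] [::] R')].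
  move=> l'V /andP[bt'1 qb'1] sR' E S.
  have [|||||s [S' E']] := IH q.+1 u' v' z' j' bt' qb' w' r' V R' l'V => //.
  - by lia.
  - by lia.
  - by rewrite sR'.
  exists s; split; last by rewrite E' E.
  by rewrite mulSn addSn addSn -addnA; apply: run_whileS S S'.
have D : run (Dec 8) (st [:: q; u; v; z; j; 0; bt; qb; k.+1; w; r] [::] R) 1
    (st [:: q; u; v; z; j; 0; bt; qb; k; w; r] [::] R).
  apply: calc_ext (calc_dec _) _ _ _ => // i.
  by rewrite /upd; do 11!case: i => [|i] //=.
have p1 : prime q <= 1 := leq_b1 _.
have A1 : run (Asg 7 primeE) (st [:: q; u; v; z; j; 0; bt; qb; k; w; r] [::] R) (G1 V)
    (st [:: q; u; v; z; j; 0; bt; nat_of_bool (prime q); k; w; r] [::] R).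
  apply: H1 => //; first by bound.
  by rewrite ev_prime.
have I q' u' v' z' j' bt' qb' w' r' R' :
    run (Inc 0) (st [:: q'; u'; v'; z'; j'; 0; bt'; qb'; k; w'; r'] [::] R') 1
    (st [:: q'.+1; u'; v'; z'; j'; 0; bt'; qb'; k; w'; r'] [::] R').
  apply: calc_ext (calc_inc _ _) _ _ _ => // i.
  by rewrite /upd; do 11!case: i => [|i] //=.
have lV1 : all (geq V) [:: q; u; v; z; j; 0; bt; nat_of_bool (prime q); k; w; r].
  by bound.
case: (boolP (prime q)) => pq.
  have [] := H0 _ _ _ _ _ _ _ _ _ _ V R lV1 _ bt1 p1 sR; first by lia.
  move=> u' [v' [z' [bt' [qb' [w' [r' [R' []]]]]]]].
  set j' := nat_of_bool _ => l'V bq sR' vR' S.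
  exists u', v', z', j', bt', qb', w', r', R'; split=> //.
  - by move: l'V => /=; lia.
  - rewrite /= pq -vR' /j'.
    by case: (j) => [|?] //=; case: (_ || block _ _ _).
  apply: run_seq D _; apply: run_seq A1 _; apply: run_seq (I _ _ _ _ _ _ _ _ _ _).
  rewrite addn1; apply: run_if; rewrite /= pq /=.
  by rewrite pq in S; apply: run_leq S; apply: leq_addr.
exists u, v, z, j, bt, 0, w, r, R; split=> //.
- by bound.
- by rewrite bt1.
- by rewrite /= (negPf pq).
apply: run_seq D _; apply: run_seq A1 _; apply: run_seq (I _ _ _ _ _ _ _ _ _ _).
rewrite addn1; apply: run_if; rewrite /= (negPf pq) /=.
by apply: (run_leq (leq_addl _ _)); apply: H2 => //; bound.
Qed.

(** The first loop measures the input twice: in counter 5 for the way back, in counter 8 for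
    computing [fuel]. *)
Definition program :=
  Seq (While NotBlank (Seq GoRight (Seq (Inc 5) (Inc 8))))
  (Seq rewind
  (Seq (Asg 8 (let a := Add (Var 8) (Cst 8) in mulE (Cst 8) (mulE a a)))
  (Seq (Asg 0 (Cst 11)) (While (NonZero 8) (Seq (Dec 8) round))))).

Lemma count_run c p L R :
  run (While NotBlank (Seq GoRight (Seq (Inc 5) (Inc 8))))
    (st [:: 0; 0; 0; 0; 0; p; 0; 0; c; 0; 0] L R) (size R * 4 + 1)
    (st [:: 0; 0; 0; 0; 0; p + size R; 0; 0; c + size R; 0; 0] (catrev R L) [::]).
Proof.
elim: R c p L => [|b R IH] c p L /=; first by rewrite !addn0; apply: run_while0.
rewrite mulSn addSn addSn; apply: (run_whileS (n := 3)) => //; last first.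
  by rewrite !addnS -!addSn; apply: IH.
rewrite -[3]/(1 + 2); apply: run_seq (run_right _ _ _ _) _.
apply: (@run_seq _ _ _ 1 _ 1); first exact: calc_inc.
apply: calc_ext (calc_inc _ _) _ _ _ => // i.
by rewrite /upd; do 11!case: i => [|i] //=.
Qed.

Lemma value_rcons w b : value (rcons w b) = value w + value w + b.
Proof. by rewrite /value -cats1 foldl_cat. Qed.

Lemma value_binary n : value (binary n) = n.
Proof.
rewrite /binary; have lt : n < 2 ^ (trunc_log 2 n).+1 by rewrite trunc_log_ltn.
move: (trunc_log 2 n).+1 lt => m; elim: m n => [|m IH] n lt.
  by case: n lt.
have -> : mkseq (fun i => odd (n %/ 2 ^ i)) m.+1 =
    odd n :: mkseq (fun i => odd (n./2 %/ 2 ^ i)) m.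
  rewrite /mkseq /= divn1; congr (_ :: _).
  rewrite -[1]addn0 iotaDl -map_comp; apply: eq_map => i /=.
  by rewrite expnD expn1 divnMA divn2.
rewrite rev_cons value_rcons IH; last by rewrite expnS in lt; lia.
by lia.
Qed.

Lemma binary_lt n : n < 2 ^ size (binary n).
Proof. by rewrite size_rev size_mkseq trunc_log_ltn. Qed.

Lemma accepted_polytime :
  polytime_decidable (fun n => accepted (fuel (size (binary n))) 11 n).
Proof.
have [G0 P0 H0] := rounds_run.
have [G1 P1 H1] :=
  @asg_run 8 (let a := Add (Var 8) (Cst 8) in mulE (Cst 8) (mulE a a)) isT.
have [G2 P2 H2] := @asg_run 0 (Cst 11) isT.
have Pc := poly_cst; have Pi := poly_id.
(* Covers every q that is tried, the number of rounds and the length of the tape. *)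
pose V N := fuel N + N + 11.
have PF : poly_bounded fuel.
  by apply: poly_mul (Pc 8) _; apply: poly_exp; apply: poly_add.
have PV : poly_bounded V := poly_add (poly_add PF Pi) (Pc 11).
have [e He] : poly_bounded (fun N => (N * 4 + 1) + ((N * 3 + 1) + (G1 (V N) +
    (G2 (V N) + (fuel N * (G0 (V N) + 1) + 1))))).
  have PG0 : poly_bounded (fun N => G0 (V N)) by apply: poly_comp.
  have PG1 : poly_bounded (fun N => G1 (V N)) by apply: poly_comp.
  have PG2 : poly_bounded (fun N => G2 (V N)) by apply: poly_comp.
  exact: (poly_add (poly_add (poly_mul Pi (Pc 4)) (Pc 1)) (poly_add
    (poly_add (poly_mul Pi (Pc 3)) (Pc 1)) (poly_add PG1 (poly_add PG2
    (poly_add (poly_mul PF (poly_add PG0 (Pc 1))) (Pc 1)))))).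
apply: (polytime_of_run (c := program) (out := 4) (e := e)) => n.
have := He (size (binary n)).
have -> : accepted (fuel (size (binary n))) 11 n =
    accepted (fuel (size (binary n))) 11 (value (binary n)) by rewrite value_binary.
move: (binary n) => w le; set N := size w in le *.
have [||||||s [S E]] := H0 (fuel N) 11 0 0 0 0 0 0 0 0 (V N) w => //.
- by rewrite /V; bound.
- by rewrite /V; lia.
- by rewrite /V -/N; lia.
exists s; split; last by rewrite E.
apply: run_leq le _.
have -> : (fun=> 0) = nth 0 [:: 0; 0; 0; 0; 0; 0; 0; 0; 0; 0; 0] :> (nat -> nat).
  by apply/funext => i; do 11!case: i => [|i] //=; rewrite nth_nil.
apply: run_seq (count_run 0 0 [::] w) _; rewrite !add0n -/N.
apply: run_seq.
  by apply: rewind_run; rewrite -[catrev w [::]]/(rev w) size_rev.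
rewrite [catrev _ [::]](revK w).
apply: run_seq (H1 _ [:: 0; 0; 0; 0; 0; 0; 0; 0; fuel N; 0; 0] _ _ _ _ _ _) _ => //.
- by rewrite /V; bound.
- by rewrite !ev_mul ev_add ev_cst /fuel expnS expn1.
apply: run_seq (H2 _ [:: 11; 0; 0; 0; 0; 0; 0; 0; fuel N; 0; 0] _ _ _ _ _ _) _ => //.
  by rewrite /V; bound.
by rewrite [G0 _ + 1]addn1.
Qed.

(** * Restricted digits modulo a prime *)

Lemma prime_odd p : prime p -> 10 < p -> p = p./2.*2.+1.
Proof.
move=> pr p10; rewrite -[LHS]odd_double_half.
by have [e|->] := even_prime pr; [rewrite e in p10|].
Qed.

(* Among 0, .., p-1 there are at most (p+1)/2 squares, and four further
   values are excluded. *)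
Lemma good_param p : prime p -> 10 < p -> good p (param p) && (param p < p).
Proof.
move=> pr p10; have pE := prime_odd pr p10; set m := p./2 in pE.
suff h : has (good p) (iota 0 p).
  have lt : param p < p by move: h; rewrite has_find size_iota.
  by have := nth_find 0 h; rewrite nth_iota // add0n lt andbT.
apply/negPn/negP => /hasPn H.
pose S := [seq x * x %% p | x <- iota 0 m.+1] ++
  [:: p - 1; p - 3; (p - 1) %/ 3; (2 * p - 1) %/ 3].
suff /(uniq_leq_size (iota_uniq 0 p)) : {subset iota 0 p <= S}.
  (* Here [10 < p] enters: (m + 1) + 4 < 2 m + 1 requires m > 4. *)
  by rewrite size_cat size_map !size_iota /=; lia.
move=> w wp; have := H w wp; move: wp; rewrite mem_iota /= add0n => wp.
rewrite /good mem_cat; case: existsP => [[x /eqP xw] _|_].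
  apply/orP; left; apply/mapP; case: (leqP x m) => xm.
    by exists (val x); rewrite ?mem_iota.
  (* A root in the upper half is replaced by its negative. *)
  exists (p - x); first by rewrite mem_iota; lia.
  rewrite -xw; have xp := ltn_ord x.
  have -> : x * x = (x + x - p) * p + (p - x) * (p - x) :> nat.
    have [d dE] : exists d, p = x + d by exists (p - x); lia.
    have -> : p - x = d by lia.
    have [e eE] : exists e, nat_of_ord x = d + e by exists (x - d); lia.
    rewrite eE (_ : d + e + (d + e) - p = e) dE ?eE; [nia|lia].
  by rewrite modnMDl.
by rewrite !negb_and !negbK => /= h; apply/orP; right; rewrite !inE; lia.
Qed.

Section Gadget.

Variable p : nat.
Hypotheses (pr : prime p) (p10 : 10 < p).

Let w := param p.

Lemma param_lt : w < p. Proof. by have /andP[] := good_param pr p10. Qed.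

Lemma param_nonsquare x : x * x %% p != w.
Proof.
have /andP[/and5P[/existsPn H _ _ _ _] _] := good_param pr p10.
have xp : x %% p < p by rewrite ltn_mod; lia.
by have := H (Ordinal xp); rewrite /= modnMm.
Qed.

Lemma param_gt0 : 0 < w.
Proof. by rewrite lt0n eq_sym -{1}(mod0n p) -{1}(mul0n 0) param_nonsquare. Qed.

(** a + b is the leading coefficient of the quadratic equation of a block, so that this equation
    never degenerates. Each of the sums is a product of factors 2, w, w + 1, w + 3, 3 w + 1. *)
Lemma coefs_add_ndvd a b :
  a \in coefs w -> b \in coefs w -> ~~ (p %| a + b).
Proof.
have /andP[/and5P[_ /eqP n1 /eqP n3 /eqP m1 /eqP m2] lt] := good_param pr p10.
have w0 := param_gt0; rewrite -/w in n1 n3 m1 m2 lt.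
have ndvd x : 0 < x -> x <> p -> x <> 2 * p -> x < 3 * p -> ~~ (p %| x).
  move=> x0 x1 x2 x3; apply/negP => /dvdnP[[|[|[|k]]]]; nia.
have D x y : ~~ (p %| x) -> ~~ (p %| y) -> ~~ (p %| x * y).
  by rewrite Euclid_dvdM // negb_or => -> ->.
have Nw : ~~ (p %| w) by apply: ndvd; lia.
have N2 : ~~ (p %| 2) by apply: ndvd; lia.
have Nw1 : ~~ (p %| w + 1) by apply: ndvd; lia.
have Nw3 : ~~ (p %| w + 3) by apply: ndvd; lia.
have N3w : ~~ (p %| 3 * w + 1) by apply: ndvd; lia.
rewrite !inE => /or3P[]/eqP-> /or3P[]/eqP->.
- by rewrite (_ : _ + _ = 2 * 2 * w); [rewrite !D|lia].
- by rewrite (_ : _ + _ = w * (w + 3)); [rewrite D|lia].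
- by rewrite (_ : _ + _ = 3 * w + 1); [|lia].
- by rewrite (_ : _ + _ = w * (w + 3)); [rewrite D|lia].
- by rewrite (_ : _ + _ = 2 * (w * (w + 1))); [rewrite !D|lia].
- by rewrite (_ : _ + _ = (w + 1) * (w + 1)); [rewrite D|lia].
- by rewrite (_ : _ + _ = 3 * w + 1); [|lia].
- by rewrite (_ : _ + _ = (w + 1) * (w + 1)); [rewrite D|lia].
- by rewrite (_ : _ + _ = 2 * (w + 1)); [rewrite D|lia].
Qed.

Local Open Scope ring_scope.

Local Notation F := 'F_p.

Lemma eqFp m n : (m%:R == n%:R :> F) = (m == n %[mod p])%N.
Proof. by rewrite -val_eqE /= !val_Fp_nat. Qed.

Lemma natFp_mod m : (m %% p)%N%:R = m%:R :> F.
Proof. by apply/eqP; rewrite eqFp modn_mod. Qed.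

Lemma natFpK (x : F) : (x : nat)%:R = x.
Proof. exact: natr_Zp. Qed.

Lemma Fp_lt (x : F) : (x < p)%N.
Proof. by have := ltn_ord x; rewrite [X in (_ < X)%N]Fp_cast. Qed.

Lemma blockP u v : reflect
  (exists a e, [/\ a \in coefs w, (e <= 1)%N & (v + e)%:R = a%:R * u%:R ^+ 2 :> F])
  (block p u v).
Proof.
apply: (iffP hasP) => [[a aw /hasP[e e1 /eqP E]]|[a [e [aw e1 /eqP E]]]].
  exists a, e; split=> //; first by move: e1; rewrite !inE => /orP[]/eqP->.
  by apply/eqP; rewrite -natrX -natrM eqFp expnS expn1; apply/eqP.
exists a => //; apply/hasP; exists e; first by rewrite !inE; lia.
by move: E; rewrite -natrX -natrM eqFp expnS expn1.
Qed.

(** The units of F_p are the powers of some g, and even powers are squares. Thus w is an odd power,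
    and z or w z is an even one unless z = 0. *)
Lemma square_or (z : F) : exists y : F, z = y ^+ 2 \/ w%:R * z = y ^+ 2.
Proof.
have [->|z0] := eqVneq z 0; first by exists 0; left; rewrite expr0n.
have [g Hg] : exists g : F, forall x : F, x != 0 -> exists i, x = g ^+ i.
  have /cyclicP[g gE] := field_unit_group_cyclic [set: {unit F}].
  exists (val g) => x x0.
  have xu : x \is a GRing.unit by rewrite unitfE.
  have : FinRing.unit F xu \in <[g]>%g by rewrite -gE inE.
  by case/cycleP => i /(congr1 val); rewrite /= FinRing.val_unitX => ->; exists i.
have w0 : w%:R != 0 :> F.
  by rewrite (eqFp w 0) mod0n modn_small ?param_lt // -lt0n param_gt0.
have sq i : ~~ odd i -> g ^+ i = (g ^+ i./2) ^+ 2.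
  by move=> oi; rewrite -exprM muln2 -[in LHS](odd_double_half i) (negPf oi).
have [[i ei] [j ej]] := (Hg z z0, Hg _ w0).
have [oi|oi] := boolP (odd i); last by exists (g ^+ i./2); left; rewrite ei sq.
have [oj|oj] := boolP (odd j).
  exists (g ^+ (j + i)./2); right; rewrite ei ej -exprD sq //.
  by rewrite oddD oi oj.
have := param_nonsquare (g ^+ j./2 : F) => /negP[].
rewrite -[w in _ == w](modn_small param_lt) -eqFp natrM natFpK -expr2 -sq //.
by rewrite -ej.
Qed.

(* With z = t - w s^2, take x = (s + y) / (w + 1) if z = y^2, and
   x = (w s + y) / (2 w) if w z = y^2. *)
Lemma quadratic_cover (s t : F) : exists x a b,
  [/\ a \in coefs w, b \in coefs w
    & a%:R * x ^+ 2 + b%:R * (s - x) ^+ 2 = t].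
Proof.
have [c1 [c2 c3]] : 2 * w \in coefs w /\ w * w + w \in coefs w /\ w + 1 \in coefs w.
  by rewrite !inE !eqxx !orbT.
have N a b : a \in coefs w -> b \in coefs w -> (a + b)%:R != 0 :> F.
  by move=> aw bw; rewrite (eqFp _ 0) mod0n -/(dvdn p _) coefs_add_ndvd.
pose W : F := w%:R.
have W1 : W + 1 != 0.
  apply/eqP => e; have /negP[] := N _ _ c3 c3.
  by rewrite (natrD _ (w + 1) (w + 1)) (natrD _ w 1) -/W e addr0.
have W2 : 2 * W != 0.
  apply/eqP => e; have /negP[] := N _ _ c1 c1.
  by rewrite (natrD _ (2 * w) (2 * w)) (natrM _ 2 w) -/W e addr0.
have [y [e|e]] := square_or (t - W * s ^+ 2).
  exists ((s + y) / (W + 1)), (w * w + w)%N, (w + 1)%N; split => //.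
  rewrite (natrD _ (w * w) w) (natrD _ w 1) natrM -/W -[t](subrK (W * s ^+ 2)) e; by field.
exists ((W * s + y) / (2 * W)), (2 * w)%N, (2 * w)%N; split => //.
rewrite (natrM _ 2 w) -/W.
have W0 : W != 0 by apply: contraNneq W2 => ->; rewrite mulr0.
have T0 : 2 != 0 :> F by apply: contraNneq W2 => ->; rewrite mul0r.
have -> : t = y ^+ 2 / W + W * s ^+ 2 by rewrite -e; field.
by field; rewrite W0.
Qed.

Definition digits (d : nat) : bool := block p (d %% p) (d %/ p %% p).

Lemma digits_cover n : exists d d',
  [/\ (d < p * p)%N, (d' < p * p)%N, digits d, digits d'
    & d + d' = n %[mod p * p]]%N.
Proof.
have p0 : (0 < p)%N by lia.
have [x [a [b [aw bw E]]]] := quadratic_cover n%:R (n %/ p)%N%:R.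
set y := _ - x in E.
pose k := ((x + y) %/ p)%N.
have xp := Fp_lt x; have yp := Fp_lt y.
have k1 : (k <= 1)%N by rewrite -ltnS ltn_divLR //; lia.
(* The carry is charged to the first summand, which has e = k; the second one has e = 0. *)
pose v : F := a%:R * x ^+ 2 - k%:R; pose v' : F := b%:R * y ^+ 2.
have dig (u z : F) : digits (u + p * z) = block p u z.
  rewrite /digits addnC mulnC modnMDl divnMDl // (modn_small (Fp_lt u)).
  by rewrite (divn_small (Fp_lt u)) addn0 (modn_small (Fp_lt z)).
exists (x + p * v)%N, (y + p * v')%N; split.
- by have := Fp_lt v; nia.
- by have := Fp_lt v'; nia.
- rewrite dig; apply/blockP; exists a, k; split => //.
  by rewrite natrD !natFpK subrK.
- rewrite dig; apply/blockP; exists b, 0%N; split => //.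
  by rewrite natrD !natFpK addr0.
have e1 : (x + y = n %% p + k * p)%N.
  rewrite [LHS](divn_eq _ p) addnC; congr (_ + _)%N.
  by apply/eqP; rewrite -eqFp natrD !natFpK /y addrC subrK.
have /eqP e2 : (k + v + v' == n %/ p %[mod p])%N.
  by rewrite -eqFp !natrD !natFpK /v addrCA subrr addr0 E.
have -> : (x + p * v + (y + p * v') = n %% p + p * (k + v + v'))%N by nia.
rewrite [in RHS](divn_eq n p) addnC [in RHS]mulnC -modnDml -muln_modr e2.
by rewrite muln_modr modnDml.
Qed.

Lemma size_quadratic_roots (K : fieldType) (a b c : K) (s : seq K) :
  a != 0 -> uniq s -> all (fun x => a * x ^+ 2 + b * x + c == 0) s ->
  (size s <= 2)%N.
Proof.
move=> a0 us rs; pose P := Poly [:: c; b; a].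
have P0 : P != 0.
  by apply: contraNneq a0 => /(congr1 (fun q : {poly K} => q`_2)); rewrite coef_Poly coef0 /= => ->.
have rP : all (root P) s.
  apply: sub_all rs => x /eqP e; rewrite /root horner_Poly /=.
  by rewrite mul0r add0r -[X in _ == X]e; apply/eqP; ring.
by have := leq_trans (max_poly_roots P0 rP us) (size_Poly [:: c; b; a]).
Qed.

(** A union bound: every element of [s] lies in some class from [r]. *)
Lemma size_leq_sum_count (T I : eqType) (c : I -> pred T) (r : seq I) (s : seq T) :
  (forall x, x \in s -> has (c^~ x) r) -> (size s <= \sum_(i <- r) count (c i) s)%N.
Proof.
elim: s => [|x s IH] H //=; rewrite big_split /= -addn1 addnC leq_add //.
  rewrite (_ : \sum_(i <- r) _ = count (c^~ x) r)%N.
    by rewrite -has_count H ?inE ?eqxx.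
  by rewrite -sum1_count [RHS]big_mkcond; apply: eq_bigr => i _; case: (c i x).
by apply: IH => y ys; apply: H; rewrite inE ys orbT.
Qed.

(** A natural number congruent to n - d modulo p^2 when d <= p^2, whatever the order of n and d. *)
Definition partner (n d : nat) : nat := n + (p * p - d).

(** 144 = 6 * 6 * 2 * 2: six choices of (a, e), six of (b, f), two of the carry k, and at most two
    roots u of the quadratic equation that they determine. *)
Lemma digits_count n :
  (count (fun d => digits d && digits (partner n d)) (iota 0 (p * p)) <= 144)%N.
Proof.
have p0 : (0 < p)%N by lia.
pose s := [seq (a, e) | a <- coefs w, e <- [:: 0; 1]]%N.
pose r := [seq (y, k) | y <- [seq (a, b) | a <- s, b <- s], k <- [:: 0; 1]]%N.
pose u d : F := d%:R; pose v d : F := (d %/ p)%N%:R.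
pose c (i : (nat * nat) * (nat * nat) * nat) d := let d' := partner n d in
  [&& v d + i.1.1.2%:R == i.1.1.1%:R * u d ^+ 2,
      v d' + i.1.2.2%:R == i.1.2.1%:R * u d' ^+ 2
    & (d %% p + d' %% p == n %% p + i.2 * p)%N].
have udE d : u d = (d %% p)%N%:R by rewrite natFp_mod.
have vdE d : v d = (d %/ p %% p)%N%:R by rewrite natFp_mod.
have sumE d : (d < p * p -> d + partner n d = n + p * p)%N.
  by rewrite /partner; lia.
rewrite -size_filter; set D := seq.filter _ _.
have uD : uniq D by rewrite filter_uniq // iota_uniq.
have DP d : d \in D -> [/\ (d < p * p)%N, digits d & digits (partner n d)].
  by rewrite mem_filter mem_iota /= add0n => /andP[/andP[? ?] ?].
have cover d : d \in D -> has (c^~ d) r.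
  move=> /DP[lt /blockP[a [e [aw e1 E]]] /blockP[b [f [bw f1 G]]]].
  have := sumE d lt; set d' := partner n d in G * => sE.
  have [k k1 kE] : exists2 k, (k <= 1)%N & (d %% p + d' %% p = n %% p + k * p)%N.
    have dp : (d %% p < p)%N by rewrite ltn_mod.
    have d'p : (d' %% p < p)%N by rewrite ltn_mod.
    exists ((d %% p + d' %% p) %/ p)%N; first by rewrite -ltnS ltn_divLR //; lia.
    rewrite [LHS](divn_eq _ p) addnC; congr (_ + _)%N.
    by rewrite modnDm sE addnC modnMDl.
  have sP a' e' : a' \in coefs w -> (e' <= 1)%N -> (a', e') \in s.
    by move=> aw' e1'; apply: allpairs_f => //; rewrite !inE; lia.
  apply/hasP; exists ((a, e), (b, f), k).
    apply: allpairs_f; last by rewrite !inE; lia.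
    by apply: allpairs_f; apply: sP.
  apply/and3P; split; apply/eqP; rewrite ?udE ?vdE -?natrD; first exact: E.
    exact: G.
  exact: kE.
apply: leq_trans (size_leq_sum_count cover) _.
apply: leq_trans (_ : \sum_(i <- r) 2 <= _)%N; last first.
  by rewrite big_const_seq iter_addn_0 count_predT /r !size_allpairs.
rewrite big_seq [X in (_ <= X)%N]big_seq; apply: leq_sum => [[[[a e] [b f]] k]] ir.
have sP a' e' : (a', e') \in s -> a' \in coefs w.
  by case/allpairsP => -[x y] [h _ [-> _]].
have [/sP aw /sP bw] : (a, e) \in s /\ (b, f) \in s.
  case/allpairsP: ir => -[x y] [+ _ [E _]]; rewrite -[(x, y).1]/x in E * => xr.
  by case/allpairsP: xr E => -[x1 x2] [h1 h2 ->] [-> ->]; split.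
have ab0 : a%:R + b%:R != 0 :> F.
  by rewrite -natrD (eqFp _ 0) mod0n -/(dvdn p _) coefs_add_ndvd.
rewrite -size_filter -(size_map u).
(* The coefficients arise by adding the conditions on the two blocks, with n - u for the second
   lower digit and v + v' = n %/ p - k. *)
pose B : F := - (b%:R * n%:R *+ 2).
pose C : F := b%:R * n%:R ^+ 2 - e%:R - f%:R + k%:R - (n %/ p)%N%:R.
apply: (size_quadratic_roots (b := B) (c := C) ab0).
  (* Within one class u determines d, because v = a u^2 - e and d < p^2. *)
  rewrite map_inj_in_uniq; [exact: (filter_uniq _ uD)|move=> d d2].
  rewrite !(mem_filter (c _)) => /andP[/and3P[/= /eqP h1 _ _] /DP[lt _ _]].
  move=> /andP[/and3P[/= /eqP h2 _ _] /DP[lt2 _ _]] uE.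
  have vE : v d = v d2 by apply: (addIr e%:R); rewrite h1 h2 uE.
  have dvp x : (x < p * p -> x %/ p < p)%N by rewrite ltn_divLR.
  rewrite (divn_eq d p) (divn_eq d2 p); congr (_ * _ + _)%N.
    by move/eqP: vE; rewrite eqFp !modn_small ?dvp // => /eqP.
  by move/eqP: uE; rewrite eqFp => /eqP.
apply/allP => _ /mapP[d + ->].
rewrite (mem_filter (c _)) => /andP[/and3P[/= /eqP h1 /eqP h2 /eqP h3] /DP[lt _ _]].
have := sumE d lt; set d' := partner n d in h2 h3 * => sE.
have uE : u d' = n%:R - u d.
  apply/eqP; rewrite eq_sym subr_eq addrC -natrD sE natrD natrM.
  by rewrite -(natFp_mod p) modnn mul0r addr0.
have vE : (d %/ p + d' %/ p + k = n %/ p + p)%N.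
  have := divn_eq d p; have := divn_eq d' p; have := divn_eq n p.
  move: sE h3 => sE h3 e1 e2 e3.
  by apply/eqP; rewrite -(eqn_pmul2r p0); apply/eqP; nia.
have {}vE : v d + v d' + k%:R = (n %/ p)%N%:R.
  by rewrite -!natrD vE natrD -(natFp_mod p) modnn addr0.
rewrite /B /C -vE; move: h1 h2; rewrite uE => h1 h2.
have -> : v d = a%:R * u d ^+ 2 - e%:R by rewrite -h1 addrK.
have -> : v d' = b%:R * (n%:R - u d) ^+ 2 - f%:R by rewrite -h2 addrK.
by apply/eqP; ring.
Qed.

End Gadget.

(** * Counting representations *)

Definition weight (k q : nat) : nat := \prod_(q <= p < q + k | prime p) (p * p).

Definition blocks (k q : nat) : nat := \sum_(q <= p < q + k | prime p) 1.

Lemma weightS k q :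
  weight k.+1 q = (if prime q then q * q else 1) * weight k q.+1.
Proof.
rewrite /weight big_ltn_cond ?addnS ?leq_addr -?addSn ?ltnS ?leq_addr //.
by case: ifP; rewrite ?mul1n.
Qed.

Lemma blocksS k q : blocks k.+1 q = prime q + blocks k q.+1.
Proof.
rewrite /blocks big_ltn_cond ?addnS ?leq_addr -?addSn ?ltnS ?leq_addr //.
by case: ifP.
Qed.

Lemma weight0 q : weight 0 q = 1.
Proof. by rewrite /weight addn0 big_geq. Qed.

Lemma accepted0 k q : accepted k q 0.
Proof. by elim: k q => //= k IH q; rewrite !div0n eqxx /= !IH; case: ifP. Qed.

(** For n below the weight, the rounds beyond [k] only see 0, for which nothing is ever left above
    the current block. *)
Lemma accepted_stable k k' q n :
  k <= k' -> n < weight k q -> accepted k' q n = accepted k q n.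
Proof.
elim: k k' q n => [|k IH] [|k'] q n //= le.
  by rewrite weight0; case: n => // _; rewrite !div0n eqxx !accepted0; case: ifP.
rewrite weightS; case: ifP => [pq lt|_ lt]; last by apply: IH => //; rewrite mul1n in lt.
congr (_ && _); apply: IH => //.
by rewrite -divnMA ltn_divLR 1?mulnC // muln_gt0 prime_gt0.
Qed.

Lemma digits_shift p d a : 0 < p -> digits p (d + p * p * a) = digits p d.
Proof.
move=> p0; have -> : d + p * p * a = a * p * p + d by lia.
by rewrite /digits modnMDl divnMDl // modnMDl.
Qed.

Lemma divn_shift p d a : d < p * p -> (d + p * p * a) %/ p %/ p = a.
Proof.
move=> dp; have p0 : 0 < p * p by case: (p * p) dp.
by rewrite -divnMA addnC mulnC divnMDl // divn_small ?addn0.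
Qed.

Lemma accepted_shift k p d a : prime p -> d < p * p -> digits p d ->
  accepted k p.+1 a -> accepted k.+1 p (d + p * p * a).
Proof.
move=> pr dp dd aa; rewrite /= pr divn_shift // aa andbT.
by rewrite -/(digits p _) digits_shift ?prime_gt0 // dd orbT.
Qed.

Lemma accepted_cover k q n : 10 < q -> n < weight k q ->
  exists a b, [/\ a + b = n, accepted k q a & accepted k q b].
Proof.
elim: k q n => [|k IH] q n q10; first by rewrite weight0; case: n => // _; exists 0, 0.
rewrite weightS; case: ifP => [pq|npq] lt; last first.
  by rewrite /= npq; apply: IH; [apply: leqW|rewrite mul1n in lt].
have q0 : 0 < q * q by rewrite muln_gt0 prime_gt0.
case: (ltnP n (q * q)) => nq.
  exists n, 0; split; rewrite ?addn0 ?accepted0 //= pq -divnMA divn_small //.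
  by rewrite accepted0.
have [d [d' [dq d'q dd dd' /eqP E]]] := digits_cover pq q10 n.
(* An excess would be a positive multiple of q^2, whereas d + d' < 2 q^2 and n >= q^2. *)
have dn : d + d' <= n.
  rewrite leqNgt; apply/negP => lt'; move: E; rewrite eqn_mod_dvd; last exact: ltnW.
  by move/dvdnP => [[|[|c]]]; nia.
have [m nE] : exists m, n = d + d' + q * q * m.
  move: E; rewrite eq_sym eqn_mod_dvd // => /dvdnP[m mE]; exists m.
  by rewrite mulnC -mE subnKC.
have mW : m < weight k q.+1 by rewrite -(ltn_pmul2l q0); lia.
have [a [b [ab aa ab']]] := IH q.+1 m (leqW q10) mW.
exists (d + q * q * a), (d' + q * q * b); split; last exact: accepted_shift.
  by rewrite nE -ab; lia.
exact: accepted_shift.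
Qed.

Lemma partner_sub p n d x : d < p * p -> d + x <= n ->
  partner p n d = n - (d + x) + (p * p + x).
Proof. by rewrite /partner; move: (p * p) => Q; lia. Qed.

Lemma subn_split n d d' x y :
  d + x <= n -> n - (d + x) = d' + y -> n - (d + d') = x + y.
Proof. by lia. Qed.

Definition decompositions (k q n : nat) : seq nat :=
  [seq a <- iota 0 n.+1 | accepted k q a && accepted k q (n - a)].

(** If a or n - a is below q^2, there are at most 2 q^2 <= B choices of a. Otherwise the low block d
    of a is one of at most 144, and each leaves at most B choices for the rest; the total is at most
    145 B. The last factor stays the same along the induction because q + k does, and it dominates
    all the terms 2 q^2. *)
Lemma size_decompositions k q n : 10 < q -> n < weight k q ->
  size (decompositions k q n) <= 145 ^ blocks k q * (2 * ((q + k) * (q + k))).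
Proof.
elim: k q n => [|k IH] q n q10.
  rewrite weight0 ltnS leqn0 => /eqP->; apply: leq_trans (_ : 1 <= _).
    by rewrite size_filter; apply: leq_trans (count_size _ _) _.
  by rewrite !muln_gt0 expn_gt0 /= addn_gt0; case: q q10.
rewrite weightS blocksS; case: ifP => [pq|npq] lt; last first.
  have -> : decompositions k.+1 q n = decompositions k q.+1 n.
    by rewrite /decompositions /= npq.
  by rewrite add0n addnS -addSn; apply: IH; [apply: leqW|rewrite mul1n in lt].
have q0 : 0 < q * q by rewrite muln_gt0 prime_gt0.
pose D := [seq d <- iota 0 (q * q) | digits q d && digits q (partner q n d)].
(* The sum required of the upper parts once the low blocks of both summands are removed. *)
pose m d := (n - (d + partner q n d %% (q * q))) %/ (q * q).
pose B := 145 ^ blocks k q.+1 * (2 * ((q.+1 + k) * (q.+1 + k))).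
pose S := iota 0 (q * q) ++ [seq n - x | x <- iota 0 (q * q)] ++
  [seq d + q * q * a | d <- D, a <- decompositions k q.+1 (m d)].
have mW d : m d < weight k q.+1.
  apply: leq_ltn_trans (leq_div2r _ (leq_subr _ _)) _.
  by rewrite ltn_divLR // mulnC.
have sub : {subset decompositions k.+1 q n <= S}.
  move=> a; rewrite mem_filter mem_iota /= add0n pq ltnS.
  case/andP => /andP[/andP[/orP[a0|da] aa] /andP[/orP[b0|db] ab]] an;
    rewrite /S !mem_cat.
  - apply/orP; left; rewrite mem_iota /= add0n.
    by move: a0; rewrite -divnMA -leqn0 -ltnS ltn_divLR // mul1n.
  - apply/orP; left; rewrite mem_iota /= add0n.
    by move: a0; rewrite -divnMA -leqn0 -ltnS ltn_divLR // mul1n.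
  - apply/orP; right; apply/orP; left; apply/mapP; exists (n - a); last by rewrite subKn.
    rewrite mem_iota /= add0n.
    by move: b0; rewrite -divnMA -leqn0 -ltnS ltn_divLR // mul1n.
  apply/orP; right; apply/orP; right.
  set a1 := a %/ q %/ q in aa; set b1 := (n - a) %/ q %/ q in ab.
  pose d := a %% (q * q).
  have dq : d < q * q by rewrite ltn_mod.
  have aE : a = d + q * q * a1 by rewrite addnC /a1 -divnMA mulnC -divn_eq.
  pose d' := (n - a) %% (q * q).
  have bE : n - a = d' + q * q * b1 by rewrite addnC /b1 -divnMA mulnC -divn_eq.
  have pE : partner q n d = n - a + q * q * a1.+1.
    by rewrite mulnS [X in _ - X]aE (partner_sub (x := q * q * a1)) // -aE.
  have dd' : partner q n d %% (q * q) = d' by rewrite pE addnC mulnC modnMDl.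
  have mE : m d = a1 + b1.
    have anE : d + q * q * a1 <= n by rewrite -aE.
    have bE' : n - (d + q * q * a1) = d' + q * q * b1 by rewrite -aE.
    rewrite /m dd' (subn_split anE bE') -mulnDr mulKn //.
  rewrite [X in X \in _]aE; apply: allpairs_f_dep.
    rewrite mem_filter mem_iota /= add0n dq andbT.
    rewrite pE digits_shift ?prime_gt0 // -(digits_shift _ a1) ?prime_gt0 // -aE.
    by apply/andP.
  rewrite mem_filter mem_iota /= add0n mE ltnS leq_addr andbT aa addKn.
  by rewrite ab.
have uD : uniq (decompositions k.+1 q n) by rewrite filter_uniq // iota_uniq.
apply: leq_trans (uniq_leq_size uD sub) _.
rewrite !size_cat size_map size_iota size_allpairs_dep.
have : sumn [seq size (decompositions k q.+1 (m d)) | d <- D] <= 144 * B.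
  apply: leq_trans (_ : size D * B <= _); last first.
    by rewrite leq_mul2r size_filter digits_count // orbT.
  elim: (D) => //= d D' IHD; rewrite mulSn leq_add //.
  by apply: IH; [apply: leqW|apply: mW].
have : q * q + q * q <= B.
  rewrite /B; have: 0 < 145 ^ blocks k q.+1 by rewrite expn_gt0.
  by move: (145 ^ _) => x; nia.
rewrite expnD expn1 addnS -addSn -mulnA -/B; lia.
Qed.

Lemma sigma_count (A : pred nat) n :
  sigma A n = count (fun a => A a && A (n - a)) (iota 0 n.+1).
Proof.
pose f (i : 'I_n.+1) : 'I_n.+1 * 'I_n.+1 := (i, rev_ord i).
pose P := [pred i : 'I_n.+1 | A i && A (n - i)].
have f_inj : injective f by move=> i j [].
rewrite -sum1_count -[iota _ _]/(index_iota 0 n.+1) big_mkord sum1_card.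
rewrite -[RHS]/(#|P|) -(fintype.card_image f_inj); apply: eq_card => -[i j].
rewrite inE /=; apply/and3P/fintype.imageP => [[Ai Aj /eqP e]|[i' /andP[Ai Aj] [-> ->]]].
  have nij : n - i = j by rewrite /= in e; lia.
  have ij : j = rev_ord i by apply: val_inj; rewrite /= subSS nij.
  by exists i; rewrite ?ij // inE /= nij Ai.
by rewrite /= subSS Ai Aj subnKC // -ltnS.
Qed.

(** * A lower bound for the number of primes *)

Lemma bin_double_ge n : 2 ^ n <= 'C(n.*2, n).
Proof.
elim: n => // n IH; rewrite doubleS expnS mul2n -addnn !binS.
case: n IH => // n IH; rewrite !binS in IH *; lia.
Qed.

Lemma logn_fact_widen p m n : prime p -> m < n ->
  logn p m`! = \sum_(1 <= k < n) m %/ p ^ k.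
Proof.
move=> pr mn; rewrite logn_fact // [RHS](big_cat_nat (n := m.+1)) //=.
rewrite [X in _ + X]big_nat [X in _ + X]big1 ?addn0 // => k /andP[mk _].
by rewrite divn_small // (leq_trans mk) // ltnW // ltn_expl // prime_gt1.
Qed.

(** In Legendre's formula the term of p^k is floor(2n/p^k) - 2 floor(n/p^k), which is at most 1, and
    vanishes when p^k > 2n. *)
Lemma pfactor_bin_double p n :
  prime p -> 0 < n -> p ^ logn p 'C(n.*2, n) <= n.*2.
Proof.
move=> pr n0; have p1 := prime_gt1 pr.
have n2 : 0 < n.*2 by rewrite double_gt0.
have b0 : 0 < 'C(n.*2, n) by rewrite bin_gt0 -addnn leq_addr.
apply: leq_trans (trunc_logP p1 n2); rewrite leq_exp2l //.
set L := trunc_log p n.*2.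
have : logn p 'C(n.*2, n) + (logn p n`! + logn p n`!) = logn p (n.*2)`!.
  have n2n : n <= n.*2 by rewrite -addnn leq_addr.
  rewrite -(bin_fact n2n) -addnn addnK addnn.
  by rewrite !lognM ?muln_gt0 ?fact_gt0 ?b0.
rewrite !(logn_fact_widen (n := n.*2.+1)) //; last by rewrite ltnS -addnn leq_addr.
rewrite -big_split /= => E.
suff H : \sum_(1 <= k < n.*2.+1) (n.*2 %/ p ^ k) <=
    \sum_(1 <= k < n.*2.+1) (n %/ p ^ k + n %/ p ^ k) +
    \sum_(1 <= k < n.*2.+1) (k <= L).
  apply: leq_trans (_ : \sum_(1 <= k < n.*2.+1) (k <= L) <= _); first by lia.
  have LS : L < n.*2.+1.
    by rewrite ltnS -(leq_exp2l _ _ p1) (leq_trans (trunc_logP p1 n2)) // ltnW // ltn_expl.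
  rewrite (big_cat_nat (n := L.+1)) //= [X in _ + X]big_nat [X in _ + X]big1 ?addn0.
    rewrite big_nat (eq_bigr (fun=> 1)); last by move=> k /andP[_]; rewrite ltnS => ->.
    by rewrite -big_nat sum_nat_const_nat subn1 muln1.
  by move=> k /andP[lk _]; rewrite leqNgt lk.
rewrite -big_split /=; apply: leq_sum => k _.
have pk : 0 < p ^ k by rewrite expn_gt0 ltnW.
case: (leqP k L) => lk /=.
  rewrite -ltnS ltn_divLR // -addnn; have := ltn_ceil n pk; nia.
rewrite divn_small //; apply: leq_trans (trunc_log_ltn _ p1) _.
by rewrite leq_exp2l.
Qed.

Lemma sum_prime_count x : \sum_(0 <= p < x.+1 | prime p) 1 = count prime (iota 0 x.+1).
Proof. by rewrite sum1_count /index_iota subn0. Qed.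

(** The central binomial coefficient is at least 2^n, and it is a product of prime powers at most
    2n, for distinct primes at most 2n. *)
Lemma chebyshev n : 0 < n -> 2 ^ n <= n.*2 ^ count prime (iota 0 n.*2.+1).
Proof.
move=> n0; apply: leq_trans (bin_double_ge n) _.
have b0 : 0 < 'C(n.*2, n) by rewrite bin_gt0 -addnn leq_addr.
have n2 : 0 < n.*2 by rewrite double_gt0.
rewrite [leqLHS](prod_prime_decomp b0) prime_decompE big_map /=.
apply: leq_trans (_ : n.*2 ^ size (primes 'C(n.*2, n)) <= _).
  have : all prime (primes 'C(n.*2, n)).
    by apply/allP => p; rewrite mem_primes => /andP[].
  elim: (primes _) => [|p s IH] /=; first by rewrite big_nil.
  move=> /andP[pr ps]; rewrite big_cons expnS leq_mul //; last exact: IH.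
  exact: pfactor_bin_double.
rewrite leq_pexp2l // -size_filter; apply: uniq_leq_size (primes_uniq _) _ => p.
rewrite mem_primes => /and3P[pr _ pC]; rewrite mem_filter pr mem_iota prime_gt0 // add1n ltnS /=.
apply: leq_trans (pfactor_bin_double pr n0).
by rewrite -{1}(expn1 p) leq_exp2l ?prime_gt1 // -pfactor_dvdn.
Qed.

(** With N + 8 < 2^j <= 2 (N + 8), the bound of [chebyshev] at 4^j yields 2^j <= 2 c for the number
    c of primes up to 2 * 4^j <= 8 (N + 8)^2. Each prime contributes at least 4 to the weight; the
    summand 8 in [fuel] makes up for the primes below 11. *)
Lemma weight_large N : 2 ^ N <= weight (fuel N) 11.
Proof.
pose j := (trunc_log 2 (N + 8)).+1.
have [jl ju] : N + 8 < 2 ^ j /\ 2 ^ j <= 2 * (N + 8).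
  by rewrite /j trunc_log_ltn // expnS leq_mul2l trunc_logP // addn_gt0 orbT.
have := @chebyshev (4 ^ j); rewrite expn_gt0 => /(_ isT).
set c := count _ _; have -> : (4 ^ j).*2 = 2 ^ (2 * j).+1.
  by rewrite expnS expnM mul2n.
rewrite -expnM leq_exp2l // => H.
have j2 : (2 * j).+1 <= 2 * 2 ^ j.
  elim: (j) => // i IHi; rewrite expnS; have : 0 < 2 ^ i by rewrite expn_gt0.
  by lia.
have c2 : 2 ^ j <= 2 * c.
  rewrite -(leq_pmul2l (expn_gt0 2 j)) -expnD addnn -mul2n expnM.
  by apply: leq_trans H _; nia.
(* The 4 accounts for 2, 3, 5 and 7. *)
have cB : c <= 4 + blocks (fuel N) 11.
  rewrite /c /blocks -sum_prime_count.
  apply: leq_trans (_ : \sum_(0 <= p < 11 + fuel N | prime p) 1 <= _); last first.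
    by rewrite (big_cat_nat (n := 11)) //= ?leq_addr // leq_add2r sum1_count.
  rewrite [leqRHS](big_cat_nat (n := (4 ^ j).*2.+1)) //= ?leq_addr //.
  have -> : (4 ^ j).*2 = 2 * (2 ^ j * 2 ^ j) by rewrite -expnMn mul2n.
  by have := leq_mul ju ju; rewrite /fuel -mulnn; lia.
have W : 4 ^ blocks (fuel N) 11 <= weight (fuel N) 11.
  rewrite /weight /blocks; elim/big_rec2: _ => // p x y pr le.
  rewrite expnD expn1; apply: leq_mul => //.
  by apply: (@leq_mul 2 2 p p); apply: prime_gt1.
apply: leq_trans W; rewrite (_ : 4 = 2 ^ 2) // -expnM leq_exp2l //.
by move: (blocks _ _) (2 ^ j) cB c2 jl => B X; lia.
Qed.

(** A new prime q + k exceeds k, hence is at least the new number of blocks and pays for the new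
    factor of both factorials; [blocks k q <= k] is carried along for this. *)
Lemma fact_weight k q : 0 < q -> (blocks k q)`! * (blocks k q)`! <= weight k q.
Proof.
move=> q0; suff [] : (blocks k q)`! * (blocks k q)`! <= weight k q /\ blocks k q <= k by [].
rewrite /blocks /weight; elim: k => [|k [IH1 IH2]]; first by rewrite addn0 !big_geq.
rewrite addnS !(big_mkcond prime) !big_nat_recr ?leq_addr //= -!big_mkcond /=.
case: ifP => _; last by rewrite muln1 addn0; split => //; apply: leqW.
split; last by lia.
rewrite addn1 factS -mulnACA mulnC leq_mul // leq_mul //; lia.
Qed.

(** * The representation function of A *)

Definition basis : pred nat := fun n => accepted (fuel (size (binary n))) 11 n.

(** The number of rounds in [basis] depends on n; this allows a common [k] for all summands of a
    given number. *)
Lemma basis_accepted n k : n < weight k 11 -> basis n = accepted k 11 n.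
Proof.
move=> lt; set f := fuel (size (binary n)).
have ltf : n < weight f 11 := leq_trans (binary_lt n) (weight_large _).
case: (leqP f k) => [le|/ltnW le]; last exact: accepted_stable.
by rewrite (accepted_stable le).
Qed.

Lemma sigma_basis n k : n < weight k 11 ->
  sigma basis n = size (decompositions k 11 n).
Proof.
move=> lt; rewrite sigma_count size_filter; apply: eq_in_count => a.
rewrite mem_iota => /andP[_]; rewrite add0n ltnS => an.
have an' : n - a <= n by apply: leq_subr.
by rewrite (basis_accepted (leq_ltn_trans an lt)) (basis_accepted (leq_ltn_trans an' lt)).
Qed.

Lemma sigma_basis_gt0 n : 0 < sigma basis n.
Proof.
have lt : n < weight (fuel (size (binary n))) 11.
  exact: leq_trans (binary_lt n) (weight_large _).
rewrite (sigma_basis lt); have [a [b [ab Aa Ab]]] := accepted_cover (leqnn 11) lt.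
rewrite size_filter -has_count; apply/hasP; exists a.
  by rewrite mem_iota /= add0n ltnS -ab leq_addr.
by rewrite Aa (_ : n - a = b) // -ab addKn.
Qed.

Lemma sigma_basis_le n : 0 < n -> exists2 b, b`! <= n &
  sigma basis n <= 145 ^ b.+1 * (2 * (11 + fuel (size (binary n))) ^ 2).
Proof.
move=> n0; pose f := fuel (size (binary n)).
have ltf : n < weight f 11 := leq_trans (binary_lt n) (weight_large _).
have ex : exists k, n < weight k 11 by exists f.
(* By minimality the range shorter by one number has weight at most n, which bounds its number b of
   blocks; the last number adds at most one block, whence [b.+1]. *)
case: (ex_minnP ex) => k lt min.
have kf : k <= f by apply: min.
case: k lt min kf => [|k] lt min kf; first by rewrite weight0 in lt; lia.
have wk : weight k 11 <= n by rewrite leqNgt; apply/negP => /min; rewrite ltnn.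
exists (blocks k 11).
  apply: leq_trans wk; apply: leq_trans (fact_weight k (isT : 0 < 11)).
  by rewrite leq_pmulr // fact_gt0.
rewrite (sigma_basis lt); apply: leq_trans (size_decompositions (leqnn 11) lt) _.
have B : blocks k.+1 11 <= (blocks k 11).+1.
  rewrite /blocks addnS !(big_mkcond prime) big_nat_recr ?leq_addr //= addnC.
  by case: ifP.
apply: leq_mul; first by rewrite leq_pexp2l.
by rewrite -mulnn leq_mul2l /= leq_mul // leq_add2l.
Qed.

(** * Estimates for factorials, logarithms and exponentials *)

Lemma fact_ge_exp m b : m ^ (b - m) <= b`!.
Proof.
elim: b => // b IH; have [mb|bm] := leqP m b; last first.
  by rewrite (_ : b.+1 - m = 0) ?fact_gt0 //; lia.
by rewrite subSn // expnS factS leq_mul // leqW.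
Qed.

Local Open Scope ring_scope.

Section Estimate.

Variable R : realType.

(** This is e < 3: from exp(-1/6) >= 5/6 one gets e <= (6/5)^6 < 3. *)
Lemma ln_nat_gt1 n : (2 < n)%N -> 1 < ln n%:R :> R.
Proof.
move=> n2; rewrite -ltr_expR lnK ?posrE ?ltr0n //; last by lia.
apply: lt_le_trans (_ : 3 <= _); last by rewrite ler_nat.
have e6 : expR (6^-1 : R) <= 6 / 5.
  rewrite -[leLHS]invrK -expRN invf_ple ?posrE ?expR_gt0 //.
  by apply: le_trans (expR_ge1Dx _); lra.
rewrite (_ : 1 = 6%:R * 6^-1 :> R); last by rewrite divff.
rewrite expRM_natl; apply: le_lt_trans (_ : (6 / 5) ^+ 6 < _); last by lra.
by apply: lerXn2r => //; rewrite ?nnegrE ?expR_ge0 //; lra.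
Qed.

(** Uses sqrt(e) <= 2, which follows from exp(-1/2) >= 1/2. *)
Lemma exp2_le_expR t (x : R) : (2 ^ t)%N%:R <= expR x -> t%:R <= 2 * x.
Proof.
move=> le; have e2 : expR (2^-1 : R) <= 2.
  rewrite -[leLHS]invrK -expRN invf_ple ?posrE ?expR_gt0 //.
  by apply: le_trans (expR_ge1Dx _); lra.
suff : expR (t%:R * 2^-1) <= expR x by rewrite ler_expR; lra.
apply: le_trans le; rewrite expRM_natl natrX.
by apply: lerXn2r => //; rewrite nnegrE ?expR_ge0.
Qed.

Variables (x : R).
Hypothesis x1 : 1 < x.

Let l := ln x.
Let y := x / l.

Let l0 : 0 < l. Proof. exact: ln_gt0. Qed.

Let sqrtx := expR (l / 2).

Let sqrtxE : x = sqrtx ^+ 2.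
Proof.
rewrite -expRM_natl mulrC -mulrA mulVf ?pnatr_eq0 // mulr1 lnK // posrE.
exact: lt_trans x1.
Qed.

Let ln_le_sqrt : l <= 2 * sqrtx.
Proof. by have := expR_ge1Dx (l / 2); rewrite -/sqrtx; lra. Qed.

Let sqrt_le : sqrtx <= 2 * y.
Proof.
have s0 : 0 < sqrtx := expR_gt0 _.
rewrite /y mulrA ler_pdivlMr // sqrtxE expr2 mulrCA ler_pM2l //.
Qed.

Let ln_le : l <= 4 * y.
Proof.
rewrite /y mulrA ler_pdivlMr // sqrtxE; have := ln_le_sqrt.
have s0 : 0 < sqrtx := expR_gt0 _; move: l0 => l0'; nra.
Qed.

(** Let m be the least integer above sqrt(x). Then sqrt(x)^(b - m) <= b! <= exp(x) gives b - m <= 2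
    y, while m <= sqrt(x) + 1 <= 2 y + 1. *)
Lemma factorial_le_expR b : b`!%:R <= expR x -> b%:R <= 4 * y + 1.
Proof.
move=> bx; pose m := (Num.truncn sqrtx).+1.
have /andP[m1 m2] : m.-1%:R <= sqrtx < m%:R by apply: Num.Theory.truncn_itv; apply: expR_ge0.
have H : expR ((b - m)%N%:R * (l / 2)) <= expR x.
  rewrite expRM_natl; apply: le_trans bx; apply: le_trans (_ : (m ^ (b - m))%N%:R <= _).
    by rewrite natrX; apply: lerXn2r; rewrite ?nnegrE ?expR_ge0 ?ler0n // ltW.
  by rewrite ler_nat fact_ge_exp.
have H2 : (b - m)%N%:R <= 2 * y.
  by move: H; rewrite ler_expR => H; rewrite /y mulrA ler_pdivlMr //; lra.
have H3 : b%:R <= (b - m)%N%:R + m.-1%:R + 1 :> R.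
  by rewrite -natrD natr1 ler_nat; lia.
by have := sqrt_le; lra.
Qed.

Lemma pow4_le : x ^+ 4 <= expR (16 * y).
Proof.
have x0 : x \in Num.pos by rewrite posrE (lt_trans _ x1).
rewrite -{1}(lnK x0) -expRM_natl ler_expR -/l; have := ln_le; lra.
Qed.

End Estimate.

Theorem theorem1p1 (R : realType) :
  exists A : pred nat, polytime_decidable A /\
  exists C c : R, [/\ 0 < C, 0 < c,
    forall n : nat, (1 <= sigma A n)%N &
    forall n : nat, (3 <= n)%N ->
      (sigma A n)%:R <= C * n%:R `^ (c / ln (ln n%:R))].
Proof.
exists basis; split; first exact: accepted_polytime.
(* With t <= 2 x and x > 1, 11 + 8 (t + 9)^2 <= (11 + 8 * 121) x^2 <= 1000 x^2. *)
pose K : R := 2 * 1000 ^+ 2; have K0 : 0 < K by rewrite mulr_gt0 ?exprn_gt0 ?ltr0n.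
(* By 145 <= exp(145) and b <= 4 y + 1, 145^(b + 1) is at most exp(290 + 580 y); [pow4_le] adds
   another 16 y. *)
exists (K * expR 290), 596; split=> [|||n n3].
- by rewrite mulr_gt0 ?expR_gt0.
- by rewrite ltr0n.
- exact: sigma_basis_gt0.
have n0 : (0 < n)%N by lia.
have nR : 0 < n%:R :> R by rewrite ltr0n.
set x : R := ln n%:R; have x1 : 1 < x := ln_nat_gt1 R n3.
set y := x / ln x.
have nE : n%:R = expR x by rewrite lnK.
have -> : n%:R `^ (596 / ln x) = expR (596 * y).
  by rewrite /powR (gt_eqF nR) -/x /y mulrAC mulrA.
have [b bn H] := sigma_basis_le n0.
have {}bn : b%:R <= 4 * y + 1.
  by apply: factorial_le_expR => //; rewrite -nE ler_nat.
have tx : (trunc_log 2 n)%:R <= 2 * x.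
  by apply: exp2_le_expR; rewrite -nE ler_nat trunc_logP.
move: H; rewrite size_rev size_mkseq -(ler_nat R) => H; apply: le_trans H _.
have N1 : (145 ^ b.+1)%:R <= expR (290 + 580 * y) :> R.
  apply: le_trans (_ : expR (b.+1%:R * 145) <= _); last first.
    by rewrite ler_expR -natr1; lra.
  rewrite expRM_natl natrX; apply: lerXn2r; rewrite ?nnegrE ?expR_ge0 //.
  by apply: le_trans (expR_ge1Dx _); lra.
have N2 : (2 * (11 + fuel (trunc_log 2 n).+1) ^ 2)%:R <= K * expR (16 * y).
  apply: le_trans (_ : K * x ^+ 4 <= _); last by rewrite ler_pM2l // pow4_le.
  rewrite /fuel natrM natrX natrD natrM natrX natrD -(natr1 (trunc_log 2 n)).
  have t0 : 0 <= (trunc_log 2 n)%:R :> R by [].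
  move: (trunc_log 2 n)%:R tx t0 => t tx t0.
  have s1 : (t + 1 + 8) ^+ 2 <= (11 * x) ^+ 2.
    by apply: lerXn2r; rewrite ?nnegrE; lra.
  have x2 : 1 <= x ^+ 2 by rewrite exprn_ege1 // ltW.
  have s2 : (11 + 8 * (t + 1 + 8) ^+ 2) ^+ 2 <= (1000 * x ^+ 2) ^+ 2.
    apply: lerXn2r; rewrite ?nnegrE; [|lra|rewrite exprMn in s1; lra].
    by rewrite addr_ge0 // mulr_ge0 // sqr_ge0.
  rewrite (exprMn 2 1000) -exprM in s2; rewrite /K -mulrA ler_pM2l //; exact: s2.
rewrite natrM; apply: le_trans (ler_pM _ _ N1 N2) _ => //.
rewrite expRD mulrACA [expR 290 * K]mulrC -expRD -mulrDl -natrD.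
exact: lexx.
Qed.
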